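(* Let the combinatorial classes $\mathcal{S}_C,\mathcal{S}_X,\mathcal{K},\mathcal{T}_K,\mathcal{T}_S,\mathcal{T}_{S-K}$ be defined by \[ \mathcal{T}_K=\mathrm{Set}_{=3}(\mathcal{Z}+\mathcal{S}_X),\quad \mathcal{T}_S=\mathcal{Z}\times\mathcal{S}_C,\quad \mathcal{T}_{S-K}=\mathcal{K}\times\mathcal{S}_X, \] \[ \mathcal{S}_C=\mathrm{Set}_{\geq 2}(\mathcal{K}),\quad \mathcal{S}_X=\mathcal{Z}\times\mathrm{Set}_{\geq 1}(\mathcal{K}),\quad \mathcal{K}=\mathrm{Set}_{=2}(\mathcal{Z}+\mathcal{S}_X). \] Then the class $\mathcal{C}$ of (unrooted) triangular cactus graphs with at least three vertices satisfies $\mathcal{C}=\mathcal{T}_K+\mathcal{T}_S-\mathcal{T}_{S-K}$, in the sense that for every $n$ the number of triangular cacti on $n$ vertices equals the number of size-$n$ objects of $\mathcal{T}_K$ plus that of $\mathcal{T}_S$ minus that of $\mathcal{T}_{S-K}$; this holds both for labeled graphs (labeled setting) and for unlabeled graphs (unlabeled setting).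
   Context: A triangular cactus (3-cactus) is a connected graph in which every edge lies on exactly one cycle, and that cycle has length 3. Combinatorial classes: $\mathcal{Z}$ consists of a single object of size 1 (an atom); $\mathcal{A}+\mathcal{B}$ is disjoint union, $\mathcal{A}\times\mathcal{B}$ is Cartesian product (sizes add); $\mathrm{Set}_{\geq k}(\mathcal{A})$ (resp. $\mathrm{Set}_{=k}(\mathcal{A})$) is the class of unordered collections of at least (resp. exactly) $k$ objects of $\mathcal{A}$, with size the total size. In the unlabeled setting these collections are multisets; in the labeled setting atoms carry distinct labels $1,\dots,n$, products are labeled products and sets are labeled sets. The system is understood to define the classes uniquely. *)

(* Defs.v *)
From HB Require Import structures.
From mathcomp Require Import all_boot all_order all_fingroup all_algebra.
From mathcomp Require Import finmap multiset boolp.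

Set Implicit Arguments.
Unset Strict Implicit.
Unset Printing Implicit Defensive.

Definition has_card (T : eqType) (P : T -> Prop) (m : nat) : Prop :=
  exists s : seq T, [/\ uniq s, size s = m & forall x, x \in s <-> P x].

(* A graph on the finite vertex type V is given by its edge set. *)
Section Graphs.
Variable V : finType.
Implicit Types (E F : {set {set V}}) (c : seq V).

Definition simple_graph E : Prop := forall e, e \in E -> #|e| = 2.

Definition adj E : rel V := fun x y => [set x; y] \in E.

Definition connected_graph E : Prop := forall x y, connect (adj E) x y.

Definition cycle_edges c : {set {set V}} := [set [set x; next c x] | x in c].

(* Cycles are subgraphs, i.e. edge sets: the starting point and the direction
   in which a cycle is listed do not matter.                                 *)
Definition graph_cycle E F : Prop :=
  exists c : seq V, [/\ 3 <= size c, ucycle (adj E) c & F = cycle_edges c].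

Definition triangular_cactus E : Prop :=
  [/\ simple_graph E, connected_graph E
    & forall e, e \in E ->
        (exists! F, graph_cycle E F /\ e \in F) /\
        (forall F, graph_cycle E F -> e \in F -> #|F| = 3)].

Definition relabel_graph (s : {perm V}) E : {set {set V}} :=
  [set [set s x | x in e] | e : {set V} in E].

Definition graph_iso : rel {set {set V}} :=
  fun E F => [exists s : {perm V}, F == relabel_graph s E].

End Graphs.

Definition labeled_cacti (n : nat) : {set {set {set 'I_n}}} :=
  [set E | (3 <= n) && `[< triangular_cactus E >]].

Definition unlabeled_cacti (n : nat) : {set {set {set {set 'I_n}}}} :=
  equivalence_partition (@graph_iso 'I_n) (labeled_cacti n).

(* There is no requirement here that there be finitely many objects of each
   size; [ucount A n m] implies it for the size n.                           *)
Record uclass := UClass { uobj :> choiceType; usize : uobj -> nat }.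

Declare Scope uclass_scope.
Delimit Scope uclass_scope with U.
Bind Scope uclass_scope with uclass.

Definition ucount (A : uclass) (n m : nat) : Prop :=
  has_card (fun x : A => usize x = n) m.

(* Equality of classes in specifications: a size-preserving bijection. *)
Definition uiso (A B : uclass) : Prop :=
  exists f : A -> B, bijective f /\ forall x, usize (f x) = usize x.

Definition uatom : uclass := @UClass unit (fun=> 1).

Definition usum (A B : uclass) : uclass :=
  @UClass (A + B)%type
    (fun x => match x with inl a => usize a | inr b => usize b end).

Definition uprod (A B : uclass) : uclass :=
  @UClass (A * B)%type (fun x => usize x.1 + usize x.2).

(* Multisets of objects of A whose number of elements, counted with
   multiplicity, satisfies p.                                                *)
Definition uset (p : pred nat) (A : uclass) : uclass :=
  @UClass {m : multiset A | p (size (enum_mset m))}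
    (fun m => \sum_(x <- enum_mset (val m)) usize x).

Notation "A + B" := (usum A B) : uclass_scope.
Notation "A * B" := (uprod A B) : uclass_scope.
Notation uset_ge k := (uset (fun i => k <= i)).
Notation uset_eq k := (uset (fun i => i == k)).

(* An object comes with the set of (distinct) labels carried by its atoms,
   which may be any finite set of integers; its size is the cardinality of
   that set.  The well-labeled objects of size n, which are the ones counted,
   are those with label set {1, ..., n}.  Allowing all label sets makes the
   usual relabelings in products and sets unnecessary: the components of a
   well-labeled object are objects with pairwise disjoint label sets.        *)
Record lclass := LClass { lobj :> choiceType; labels : lobj -> {fset nat} }.

Declare Scope lclass_scope.
Delimit Scope lclass_scope with L.
Bind Scope lclass_scope with lclass.

Definition lcount (A : lclass) (n m : nat) : Prop :=
  has_card (fun x : A => labels x = [fset i in iota 1 n]%fset) m.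

Definition liso (A B : lclass) : Prop :=
  exists f : A -> B, bijective f /\ forall x, labels (f x) = labels x.

Definition latom : lclass := @LClass nat (fun i => [fset i]%fset).

Definition lsum (A B : lclass) : lclass :=
  @LClass (A + B)%type
    (fun x => match x with inl a => labels a | inr b => labels b end).

Definition lprod (A B : lclass) : lclass :=
  @LClass {x : A * B | [disjoint labels x.1 & labels x.2]%fset}
    (fun x => (labels (val x).1 `|` labels (val x).2)%fset).

Definition pairwise_disjoint (A : lclass) (s : {fset A}) : bool :=
  [forall x : s, forall y : s,
     (x != y) ==> [disjoint labels (val x) & labels (val y)]%fset].

Definition lset (p : pred nat) (A : lclass) : lclass :=
  @LClass {s : {fset A} | p #|` s|%fset && pairwise_disjoint s}
    (fun s => (\bigcup_(x <- val s) labels x)%fset).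

Notation "A + B" := (lsum A B) : lclass_scope.
Notation "A * B" := (lprod A B) : lclass_scope.
Notation lset_ge k := (lset (fun i => k <= i)).
Notation lset_eq k := (lset (fun i => i == k)).

(* Main.v *)
(* A cactus rooted at a vertex is encoded by a decomposition tree, unique up to
   reordering the triangles around its vertices; both the objects of the classes
   and the vertex-rooted cactus graphs are these trees up to that equivalence.
   Hence T_S, T_K and T_{S-K} count cacti marked at a cut vertex, at a triangle,
   and at an incidence of a triangle with a cut vertex, up to the group of
   permutations fixing the labels (trivial in the labeled setting, full in the
   unlabeled one).

   These are the nodes and edges of a tree (the leaves at the vertices of a single
   triangle being pruned).  Orient each incidence (T, v) towards v if the component
   of v after the removal of the edges of T has more than half of the vertices,
   and towards T otherwise.  Each node is the source of at most one incidence, and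
   an Euler count shows that exactly one node, the centroid, is a sink.  The
   orientation is invariant under relabeling, so matching the other nodes with
   their outgoing incidences gives the identity on orbits. *)

Require Import Defs.
From HB Require Import structures.
From mathcomp Require Import all_boot all_order all_fingroup all_algebra.
From mathcomp Require Import finmap multiset boolp zify.

Set Implicit Arguments.
Unset Strict Implicit.
Unset Printing Implicit Defensive.

(** * Decomposition trees *)

(** The difficulty is to make two unrelated definitions meet: cacti are graphs constrained by their
    cycles, while the classes are known only up to bijections satisfying a recursive system. On the
    side of classes, [rep] relates trees to objects by recursion on the tree, and the finite number
    of atoms of an object replaces an explicit solution of the system. On the side of graphs, the
    cycle condition is global and awkward to restrict, so it is traded for a condition on each edge:
    it lies in a triangle whose corners fall into distinct components once the edges of the triangle
    are deleted. Components inherit this condition, which allows a tree to be built by induction.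

    The two settings differ only by a map [f] from vertices to labels, injective in one and constant
    in the other. Trees on the vertices whose [f]-images give the same object differ by [keq] and by
    a permutation [s] with [f \o s =1 f], so that objects correspond to orbits. The dissymmetry is
    therefore proved once, for the orbits of an arbitrary group of permutations. *)

(* [Add t a b] glues to [t], at its root, a triangle whose two other corners are
   the roots of [a] and [b].  A cactus rooted at a vertex thus has one such tree
   for each ordering of the triangles around its vertices and of their corners. *)
Inductive tree (L : Type) := Leaf of L | Add of tree L & tree L & tree L.

(* The marked cacti counted by T_S, T_{S-K} and T_K respectively.  A tree t is read
   as a cactus marked at its root, at the incidence of its root with the last
   triangle added there, or at that triangle; [keq k] identifies the trees of the
   same marked cactus. *)
Inductive kind := Vertex | Flag | Triangle.

Section Trees.
Variable L : Type.
Implicit Types t u a b c d : tree L.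

Fixpoint root t := match t with Leaf l => l | Add t _ _ => root t end.

Fixpoint lab t :=
  match t with Leaf l => [:: l] | Add t a b => lab t ++ lab a ++ lab b end.

(** Subtrees are compared by [Vertex] whatever [k] is, since a subtree is attached by its root
    alone. [keq_exchange] is confined to [Vertex] because it changes which triangle is the last one,
    and [keq_rot] to [Triangle] because it changes the root. *)
Inductive keq : kind -> tree L -> tree L -> Prop :=
| keq_refl k t : keq k t t
| keq_trans k t u v : keq k t u -> keq k u v -> keq k t v
| keq_cong k t a b t' a' b' : keq Vertex t t' -> keq Vertex a a' ->
    keq Vertex b b' -> keq k (Add t a b) (Add t' a' b')
| keq_swap k t a b : keq k (Add t a b) (Add t b a)
| keq_exchange t a b c d :
    keq Vertex (Add (Add t a b) c d) (Add (Add t c d) a b)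
| keq_rot t a b : keq Triangle (Add t a b) (Add b t a).

(* For [Vertex] and [Flag] the root lies in at least two triangles: S_C is a set
   of at least two K's, and S_X has at least one besides the K of K x S_X. *)
Definition valid k t :=
  match k, t with
  | Triangle, Add _ _ _ | _, Add (Add _ _ _) _ _ => true
  | _, _ => false
  end.

Lemma keq_sym k t u : keq k t u -> keq k u t.
Proof.
elim=> {k t u} [k t|k t u v _ IHt _ IHu|k t a b t' a' b' _ IHt _ IHa _ IHb|k t a b|t a b c d|t a b].
- exact: keq_refl.
- exact: keq_trans IHu IHt.
- exact: keq_cong.
- exact: keq_swap.
- exact: keq_exchange.
- by apply: (keq_trans (u := Add a b t)); apply: keq_rot.
Qed.

Lemma keq_rotr t a b : keq Triangle (Add t a b) (Add a b t).
Proof. by apply: (keq_trans (u := Add b t a)); apply: keq_rot. Qed.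

Lemma keq_valid k t u : keq k t u -> valid k t = valid k u.
Proof.
have deg t' u' : keq Vertex t' u' ->
    (if t' is Leaf _ then true else false) = (if u' is Leaf _ then true else false).
  move Ek: Vertex => k0 tu; elim: tu Ek => {k0 t' u'} // k0 t' u' v _ IHt _ IHu Ek.
  by rewrite IHt // IHu.
elim=> {k t u} //.
- by move=> k t u v _ -> _ ->.
- by case=> t a b t' a' b' /deg + _ _ _ _; case: t => //=; case: t' => //=.
Qed.

Lemma valid_triangle k t : valid k t -> valid Triangle t.
Proof. by case: k t => -[] // []. Qed.

Lemma size_lab_gt0 t : 0 < size (lab t).
Proof. by elim: t => //= t IHt a _ b _; rewrite size_cat addn_gt0 IHt. Qed.

End Trees.

Arguments keq_trans {L k t} u {v}.

Fixpoint tmap L M (f : L -> M) t :=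
  match t with
  | Leaf l => Leaf (f l)
  | Add t a b => Add (tmap f t) (tmap f a) (tmap f b)
  end.

Section TreeMap.
Variables L M : Type.
Implicit Types (f : L -> M) (t a b : tree L) (u : tree M).

Lemma root_tmap f t : root (tmap f t) = f (root t).
Proof. by elim: t. Qed.

Lemma lab_tmap f t : lab (tmap f t) = map f (lab t).
Proof. by elim: t => //= t -> a -> b ->; rewrite !map_cat. Qed.

Lemma valid_tmap f k t : valid k (tmap f t) = valid k t.
Proof. by case: k t => -[] //= []. Qed.

Lemma keq_tmap f k t t' : keq k t t' -> keq k (tmap f t) (tmap f t').
Proof.
elim=> /= {k t t'} *;
  by [exact: keq_refl|apply: keq_trans; eassumption|exact: keq_cong
     |exact: keq_swap|exact: keq_exchange|exact: keq_rot].
Qed.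

(** The rules of [keq] move subtrees around without looking at labels, so a rewriting of the image
    can be replayed on [t] even when [f] is not injective. The unlabeled count rests on this. *)
Lemma keq_tmap_lift f k t u :
  keq k (tmap f t) u -> exists2 t', keq k t t' & tmap f t' = u.
Proof.
move Ev: (tmap f t) => v vu.
elim: vu t Ev => {k u v} [k v|k v u w _ IHv _ IHu
  |k v a b v' a' b' _ IHv _ IHa _ IHb|k v a b|v a b c d|v a b] t.
- by exists t => //; apply: keq_refl.
- move=> /IHv[t1 tt1 /IHu[t2 t12 <-]].
  by exists t2 => //; apply: keq_trans tt1 t12.
- case: t => //= t ta tb [/IHv[t1 ? <-] /IHa[t2 ? <-] /IHb[t3 ? <-]].
  by exists (Add t1 t2 t3) => //; apply: keq_cong.
- case: t => //= t ta tb [<- <- <-].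
  by exists (Add t tb ta) => //; apply: keq_swap.
- case: t => //= -[] //= t ta tb tc td [<- <- <- <- <-].
  by exists (Add (Add t tc td) ta tb) => //; apply: keq_exchange.
- case: t => //= t ta tb [<- <- <-].
  by exists (Add tb t ta) => //; apply: keq_rot.
Qed.

Lemma tmap_fill f u s : map f s = lab u -> exists2 t, lab t = s & tmap f t = u.
Proof.
have split_map s0 (x y : seq M) : map f s0 = x ++ y ->
    exists s1 s2, [/\ s0 = s1 ++ s2, map f s1 = x & map f s2 = y].
  move=> Es; exists (take (size x) s0), (drop (size x) s0).
  by rewrite cat_take_drop map_take map_drop Es take_size_cat ?drop_size_cat.
elim: u s => [m|u IHu a IHa b IHb] s /=.
  by case: s => [|l []] //= [<-]; exists (Leaf l).
move=> /split_map[s1 [s' [-> /IHu[t <- <-] /split_map[s2 [s3]]]]].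
by case=> -> /IHa[ta <- <-] /IHb[tb <- <-]; exists (Add t ta tb).
Qed.

End TreeMap.

(** Equal images force equal shapes; the labels read from left to right then determine the trees. *)
Lemma tmap_positional L (M : eqType) N (f : L -> N) (f' : M -> N) (g : L -> M) t t' :
  tmap f t = tmap f' t' -> map g (lab t) = lab t' -> tmap g t = t'.
Proof.
elim: t t' => [l|t IHt a IHa b IHb] [l'|t' a' b'] //= => [_ [->] //|].
move=> [Et Ea Eb].
have szE x x' : tmap f x = tmap f' x' -> size (map g (lab x)) = size (lab x').
  by move/(congr1 (size \o @lab _)); rewrite /= !lab_tmap !size_map.
rewrite !map_cat => /eqP; rewrite eqseq_cat; last exact: szE.
case/andP=> /eqP lt; rewrite eqseq_cat; last exact: szE.
by case/andP=> /eqP la /eqP lb; rewrite (IHt t') // (IHa a') // (IHb b').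
Qed.

Lemma tmap_comp L M N (g : M -> N) (f : L -> M) t :
  tmap g (tmap f t) = tmap (g \o f) t.
Proof. by elim: t => //= t -> a -> b ->. Qed.

Lemma eq_tmap L M (f g : L -> M) t : f =1 g -> tmap f t = tmap g t.
Proof. by move=> fg; elim: t => [l|t IHt a IHa b IHb] /=; congruence. Qed.

Lemma keq_lab (L : eqType) k (t t' : tree L) : keq k t t' -> perm_eq (lab t) (lab t').
Proof.
elim=> {k t t'} //=.
- by move=> k t u v _ + _; apply: perm_trans.
- by move=> k t a b t' a' b' _ ? _ ? _ ?; do ?apply: perm_cat.
- by move=> k t a b; rewrite perm_cat2l perm_catC.
- by move=> t a b c d; rewrite -!catA perm_cat2l catA perm_catC -catA.
- by move=> t a b; rewrite catA perm_catC.
Qed.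

Lemma mem_root (L : eqType) (t : tree L) : root t \in lab t.
Proof. by elim: t => [l|t IHt a _ b _] /=; rewrite ?inE // mem_cat IHt. Qed.

(** * Classes satisfying the specification *)

(* The common part of the labeled and the unlabeled setting: [obj] is Z + S_X and
   [tri] is K, both with the list of their atoms; L is nat with [wf := uniq], or
   unit with [wf] always true.  Sets and multisets both become lists up to
   permutation, and an atom of Z is an [obj] without [kids]. *)
Record spec (L : eqType) := Spec {
  wf : pred (seq L);
  obj : eqType;
  tri : eqType;
  olab : obj -> seq L;
  tlab : tri -> seq L;
  oroot : obj -> L;
  kids : obj -> seq tri;
  corners : tri -> seq obj;
  wf_perm : forall s1 s2, perm_eq s1 s2 -> wf s1 -> wf s2;
  wf_catl : forall s1 s2, wf (s1 ++ s2) -> wf s1;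
  wf_olab : forall o, wf (olab o);
  olabE : forall o, perm_eq (olab o) (oroot o :: flatten (map tlab (kids o)));
  tlabE : forall k, perm_eq (tlab k) (flatten (map olab (corners k)));
  size_corners : forall k, size (corners k) = 2;
  obj_inj : forall o1 o2,
    oroot o1 = oroot o2 -> perm_eq (kids o1) (kids o2) -> o1 = o2;
  tri_inj : forall k1 k2, perm_eq (corners k1) (corners k2) -> k1 = k2;
  obj_ex : forall i s, wf (i :: flatten (map tlab s)) ->
    exists2 o, oroot o = i & perm_eq (kids o) s;
  tri_ex : forall s, size s = 2 -> wf (flatten (map olab s)) ->
    exists k, perm_eq (corners k) s }.

Section SpecTheory.
Variables (L : eqType) (S : spec L).
Implicit Types (t a b : tree L) (o oa ob : obj S) (k : tri S).

Lemma wf_catr s1 s2 : wf S (s1 ++ s2) -> wf S s2.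
Proof.
by move=> w; apply: (@wf_catl _ S s2 s1); apply: wf_perm w; rewrite perm_catC.
Qed.

Lemma perm_flatten_map (T : eqType) (F : T -> seq L) s1 s2 :
  perm_eq s1 s2 -> perm_eq (flatten (map F s1)) (flatten (map F s2)).
Proof. by move=> p12; apply: perm_flatten; apply: perm_map. Qed.

Lemma perm_pair (T : eqType) (x y x' y' : T) :
  perm_eq [:: x; y] [:: x'; y'] -> (x = x' /\ y = y') \/ (x = y' /\ y = x').
Proof.
move=> pxy; have := perm_mem pxy x; rewrite !inE eqxx /= => /esym/orP[]/eqP Ex.
  by move: pxy; rewrite Ex perm_cons => /(@perm_small_eq _ _ [:: y'] isT)[->]; left.
have {}pxy: perm_eq [:: x; y] [:: y'; x'] by rewrite (perm_trans pxy) // (perm_catC [:: x']).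
by move: pxy; rewrite Ex perm_cons => /(@perm_small_eq _ _ [:: x'] isT)[->]; right.
Qed.

(** The labels that remain without the triangle form part of a well-formed list, so [obj_ex]
    rebuilds the remaining object. *)
Lemma obj_split k o s : perm_eq (kids o) (k :: s) ->
  exists2 o0, oroot o0 = oroot o & perm_eq (kids o0) s.
Proof.
move=> ps; apply: obj_ex; have := wf_olab o => /(wf_perm (olabE o)).
move/(wf_perm (s2 := (oroot o :: flatten (map (@tlab L S) s)) ++ tlab k)).
move/(_ _)/wf_catl; apply.
rewrite perm_cons perm_sym perm_catC -[tlab k ++ _]/(flatten (map _ (k :: s))).
by rewrite perm_sym; apply: perm_flatten_map.
Qed.

(** A relation rather than a function: from objects to trees an order must be chosen, and from trees
    to objects repeated labels may prevent existence. *)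
Fixpoint rep t o : Prop :=
  match t with
  | Leaf l => oroot o = l /\ kids o = [::]
  | Add t a b => exists o0 k, [/\ rep t o0,
      exists oa ob, [/\ rep a oa, rep b ob & perm_eq (corners k) [:: oa; ob]],
      oroot o0 = oroot o & perm_eq (kids o) (k :: kids o0)]
  end.

Definition rep_pair a b k :=
  exists oa ob, [/\ rep a oa, rep b ob & perm_eq (corners k) [:: oa; ob]].

Lemma rep_fun t o o' : rep t o -> rep t o' -> o = o'.
Proof.
elim: t o o' => [l|t IHt a IHa b IHb] o o' /=.
  by move=> [<- Ek] [Er Ek']; apply: obj_inj; rewrite ?Er // Ek Ek'.
move=> [o0 [k [to0 [oa [ob [aoa bob kab]]] r0 c0]]].
move=> [o1 [k' [to1 [oa' [ob' [aoa' bob' kab']]] r1 c1]]].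
rewrite -(IHt _ _ to0 to1) -(IHa _ _ aoa aoa') -(IHb _ _ bob bob') in r1 c1 kab'.
have Ek: k = k' by apply: tri_inj; rewrite (perm_trans kab) // perm_sym.
by apply: obj_inj; rewrite -?r0 // (perm_trans c0) // perm_sym Ek.
Qed.

Lemma rep_pair_fun a b k k' : rep_pair a b k -> rep_pair a b k' -> k = k'.
Proof.
move=> [oa [ob [aoa bob kab]]] [oa' [ob' [aoa' bob' kab']]]; apply: tri_inj.
by rewrite (perm_trans kab) // perm_sym (rep_fun aoa aoa') (rep_fun bob bob').
Qed.

Lemma rep_pair_swap a b k : rep_pair a b k -> rep_pair b a k.
Proof.
move=> [oa [ob [aoa bob kab]]]; exists ob, oa; split=> //.
by rewrite (perm_trans kab) // (perm_catC [:: oa]).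
Qed.

Lemma rep_keq t t' o : keq Vertex t t' -> rep t o -> rep t' o.
Proof.
move Ek: Vertex => k0 tt'; elim: tt' Ek o => {k0 t t'} //.
- by move=> k0 t u v _ IHt _ IHu Ek o /(IHt Ek)/(IHu Ek).
- move=> k0 t a b t' a' b' _ IHt _ IHa _ IHb _ o /=.
  move=> [o0 [k [/IHt to0 [oa [ob [/IHa aoa /IHb bob kab]]] r0 c0]]].
  by exists o0, k; split; auto; exists oa, ob; split; auto.
- move=> k0 t a b _ o /= [o0 [k [? /rep_pair_swap ? ? ?]]].
  by exists o0, k.
- move=> t a b c d _ o /= [o0 [k [[o1 [k' [to1 abk' r1 c1]]] cdk r0 c0]]].
  have co: perm_eq (kids o) (k' :: k :: kids o1).
    rewrite (perm_trans c0) // perm_sym (perm_catCA [:: k'] [:: k]) /= perm_cons.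
    by rewrite perm_sym.
  have [o2 r2 c2] := obj_split co.
  exists o2, k'; split=> //; last by rewrite (perm_trans co) // perm_cons perm_sym.
  by exists o1, k; split; rewrite ?r1 ?r2.
Qed.

(** Exchanges at the root bring any of its triangles to the top: by induction it is at the top of
    the inner tree, and one more exchange passes it over the last triangle. *)
Lemma rep_extract t o k : rep t o -> k \in kids o ->
  exists t1 a b o1, [/\ keq Vertex t (Add t1 a b), rep t1 o1, rep_pair a b k,
    oroot o1 = oroot o & perm_eq (kids o) (k :: kids o1)].
Proof.
elim: t o => [l|t IHt a _ b _] o /=; first by case=> _ ->.
case=> o0 [k' [to0 abk' r0 c0]]; rewrite (perm_mem c0) inE.
have [-> _|k'k /= /(IHt _ to0)] := eqVneq k k'.
  by exists t, a, b, o0; split=> //; apply: keq_refl.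
move=> [t1 [a' [b' [o1 [tt1 t1o1 abk r1 c1]]]]].
have co: perm_eq (kids o) (k :: k' :: kids o1).
  rewrite (perm_trans c0) // perm_sym (perm_catCA [:: k] [:: k']) /= perm_cons.
  by rewrite perm_sym.
have [o2 r2 c2] := obj_split co.
exists (Add t1 a b), a', b', o2; split=> //.
- apply: (keq_trans (Add (Add t1 a' b') a b)); last exact: keq_exchange.
  by apply: keq_cong => //; apply: keq_refl.
- by exists o1, k'; split; rewrite ?r1 ?r2.
- by rewrite (perm_trans co) // perm_cons perm_sym.
Qed.

Lemma rep_pair_det a b a' b' k :
  (forall o u, rep a o -> rep u o -> keq Vertex a u) ->
  (forall o u, rep b o -> rep u o -> keq Vertex b u) ->
  rep_pair a b k -> rep_pair a' b' k ->
  (keq Vertex a a' /\ keq Vertex b b') \/ (keq Vertex a b' /\ keq Vertex b a').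
Proof.
move=> IHa IHb [oa [ob [aoa bob kab]]] [oa' [ob' [aoa' bob' kab']]].
have: perm_eq [:: oa; ob] [:: oa'; ob'] by apply: perm_trans kab'; rewrite perm_sym.
by case/perm_pair=> -[Ea Eb]; subst; [left|right]; split; eauto.
Qed.

(** The last triangle of [t] is brought to the top of [t'] by [rep_extract]. What remains at the
    root is then the same object by [obj_inj], and the other two corners agree in one of the two
    orders. *)
Lemma rep_det t t' o : rep t o -> rep t' o -> keq Vertex t t'.
Proof.
elim: t t' o => [l|t IHt a IHa b IHb] t' o.
  case: t' => [l'|t' a' b'] /= [<- Ek]; first by case=> <- _; exact: keq_refl.
  by case=> o0 [k [_ _ _]]; rewrite Ek => /perm_size.
move=> /= [o0 [k [to0 abk r0 c0]]] t'o.
have kin: k \in kids o by rewrite (perm_mem c0) mem_head.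
have [t1 [a1 [b1 [o1 [t't1 t1o1 abk1 r1 c1]]]]] := rep_extract t'o kin.
have Eo: o0 = o1.
  apply: obj_inj; first by rewrite r1.
  by rewrite -(perm_cons k); apply: perm_trans c1; rewrite perm_sym.
apply: keq_trans (keq_sym t't1); rewrite {}Eo in to0.
have tt1 := IHt _ _ to0 t1o1.
have [[aa bb]|[ab ba]] := rep_pair_det (fun o u => IHa u o) (fun o u => IHb u o) abk abk1.
- exact: keq_cong.
- by apply: keq_trans (keq_swap _ _ _ _); apply: keq_cong.
Qed.

Lemma rep_lab t o : rep t o -> perm_eq (lab t) (olab o).
Proof.
elim: t o => [l|t IHt a IHa b IHb] o /=.
  by move=> [<- Ek]; rewrite perm_sym (perm_trans (olabE o)) // Ek.
move=> [o0 [k [/IHt to0 [oa [ob [/IHa aoa /IHb bob kab]]] r0 c0]]].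
rewrite perm_sym (perm_trans (olabE o)) //.
have := perm_flatten_map (@tlab L S) c0; rewrite -(perm_cons (oroot o)).
move/perm_trans->; rewrite //= -r0 -cat1s perm_catCA perm_catC perm_cat //.
  by rewrite perm_sym (perm_trans to0) // olabE.
rewrite (perm_trans (tlabE k)) // (perm_trans (perm_flatten_map _ kab)) //=.
by rewrite cats0 perm_sym perm_cat.
Qed.

Lemma rep_pair_lab a b k : rep_pair a b k -> perm_eq (lab a ++ lab b) (tlab k).
Proof.
move=> [oa [ob [/rep_lab aoa /rep_lab bob kab]]].
rewrite perm_sym (perm_trans (tlabE k)) // (perm_trans (perm_flatten_map _ kab)) //=.
by rewrite cats0 perm_sym perm_cat.
Qed.

(** The recursive system is well founded because every object has finitely many atoms and at least
    one: the remainder and the two corners of a triangle at the root all have fewer atoms than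
    [o]. *)
Lemma rep_tot o : exists t, rep t o.
Proof.
move: {2}(size _) (leqnn (size (olab o))) => m; elim: m o => [|m IHm] o.
  by rewrite (perm_size (olabE o)).
case Ek: (kids o) => [|k s]; first by exists (Leaf (oroot o)).
have [|o0 r0 c0] := @obj_split k o s; first by rewrite Ek.
have sz oa ob : perm_eq (corners k) [:: oa; ob] ->
    size (olab o) = size (olab o0) + (size (olab oa) + size (olab ob)).
  move=> kab; rewrite (perm_size (olabE o)) Ek /= size_cat (perm_size (tlabE k)).
  rewrite (perm_size (perm_flatten_map _ kab)) /= cats0 size_cat.
  rewrite (perm_size (olabE o0)) /= (perm_size (perm_flatten_map _ c0)).
  by rewrite addnC.
case Ec: (corners k) (size_corners k) sz => [|oa [|ob []]] // _ /(_ _ _ (perm_refl _)) ->.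
have gt0 o' : 0 < size (olab o') by rewrite (perm_size (olabE o')).
have := (gt0 o0, gt0 oa, gt0 ob) => -[[gt0o gt0a] gt0b] lem.
have [|t to] := IHm o0; first by lia.
have [|a aoa] := IHm oa; first by lia.
have [|b bob] := IHm ob; first by lia.
exists (Add t a b), o0, k; split=> //; last by rewrite Ek perm_cons perm_sym.
by exists oa, ob; rewrite Ec.
Qed.

Lemma rep_pair_ex a b : (forall t, t = a \/ t = b -> wf S (lab t) -> exists o, rep t o) ->
  wf S (lab a ++ lab b) -> exists k, rep_pair a b k.
Proof.
move=> IH wab; have [||oa aoa] := IH a; [by left|exact: wf_catl wab|].
have [||ob bob] := IH b; [by right|exact: wf_catr wab|].
have [||k kab] := @tri_ex _ S [:: oa; ob]; rewrite //=; last by exists k, oa, ob.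
by apply: wf_perm wab; rewrite cats0 perm_cat ?rep_lab.
Qed.

Lemma rep_ex t : wf S (lab t) -> exists o, rep t o.
Proof.
elim: t => [l|t IHt a IHa b IHb] /= w.
  have [//|o ro /perm_nilP co] := @obj_ex _ S l [::].
  by exists o.
have [o0 to0] := IHt (wf_catl w).
have [||k abk] := @rep_pair_ex a b; [by move=> t1 [->|->]|exact: wf_catr w|].
have [|o ro co] := @obj_ex _ S (oroot o0) (k :: kids o0).
  apply: wf_perm w; rewrite /= -cat1s perm_sym perm_catCA perm_catC perm_sym.
  apply: perm_cat; last exact: rep_pair_lab.
  by rewrite (perm_trans (rep_lab to0)) // olabE.
by exists o, o0, k.
Qed.


(** The interface between a class of the dissymmetry and trees: [R] identifies [T] with the valid
    trees modulo [keq q], as far as their labels are well formed. *)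
Record model (q : kind) (T : Type) (lT : T -> seq L) (R : tree L -> T -> Prop) : Prop := Model {
  model_keq : forall t t' x, keq q t t' -> R t x -> R t' x;
  model_det : forall t t' x, R t x -> R t' x -> keq q t t';
  model_fun : forall t x x', R t x -> R t x' -> x = x';
  model_tot : forall x, exists t, R t x;
  model_ex : forall t, valid q t -> wf S (lab t) -> exists x, R t x;
  model_lab : forall t x, R t x -> perm_eq (lab t) (lT x);
  model_valid : forall t x, R t x -> valid q t }.

Lemma rep_kids t o : rep t o ->
  match t with
  | Leaf _ => size (kids o) = 0
  | Add (Leaf _) _ _ => size (kids o) = 1
  | _ => 1 < size (kids o)
  end.
Proof.
case: t => [l [_ ->]|[l|t c d] a b] //= [o0 [k [+ _ _ co]]]; rewrite (perm_size co) /=.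
  by case=> _ ->.
by case=> o1 [k1 [_ _ _ c1]]; rewrite (perm_size c1).
Qed.

(** A pair in Z x Set_{>=2}(K) has the same data as an object of Z + S_X with at least two kids; [d]
    is this embedding. *)
Lemma vertex_model (T : Type) (lT : T -> seq L) (d : T -> obj S) :
    injective d -> (forall x, perm_eq (olab (d x)) (lT x)) ->
    (forall o, 1 < size (kids o) <-> exists x, d x = o) ->
  model Vertex lT (fun t x => rep t (d x)).
Proof.
move=> injd ld imd; split.
- by move=> t t' x; apply: rep_keq.
- by move=> t t' x; apply: rep_det.
- by move=> t x x' /rep_fun tx /tx/injd.
- by move=> x; apply: rep_tot.
- move=> t vt /rep_ex[o to]; have [+ _] := imd o; case=> [|x Ex]; last by exists x; rewrite Ex.
  by case: t vt to => // -[] // t c e a b _ /rep_kids.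
- by move=> t x /rep_lab tx; apply: perm_trans (ld x).
- move=> t x /rep_kids; have [_ /(_ _)] := imd (d x); move/(_ (ex_intro _ _ erefl)).
  by case: t => [l|[l|t c e] a b] //; case: (size _) => [|[]].
Qed.

Lemma vertex_model_kids (T : Type) (lT : T -> seq L) (r : T -> L) (ks : T -> seq (tri S)) :
    (forall x, wf S (r x :: flatten (map (@tlab L S) (ks x)))) ->
    (forall x, 1 < size (ks x)) ->
    (forall x y, r x = r y -> perm_eq (ks x) (ks y) -> x = y) ->
    (forall i s, wf S (i :: flatten (map (@tlab L S) s)) -> 1 < size s ->
      exists2 x, r x = i & perm_eq (ks x) s) ->
    (forall x, perm_eq (r x :: flatten (map (@tlab L S) (ks x))) (lT x)) ->
  exists R, model Vertex lT R.
Proof.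
move=> wfx szx injx exx lx.
(* T_S is built from S_C and not from S_X, so the embedding has to be obtained by reassembling root
   and kids into an [obj]. *)
have ex_d x : exists o : obj S, oroot o = r x /\ perm_eq (kids o) (ks x).
  by have [o] := obj_ex (wfx x); exists o.
have [d dP] := choice ex_d.
exists (fun t x => rep t (d x)); apply: vertex_model => [x y E|x|o].
- have [[rx kx] [ry ky]] := (dP x, dP y); apply: injx; first by rewrite -rx -ry E.
  by rewrite -(permPl kx) E.
- have [rx kx] := dP x; apply: perm_trans (lx x); apply: perm_trans (olabE _) _.
  by rewrite rx perm_cons perm_flatten_map.
split=> [sz|[x <-]]; last by have [_ /perm_size ->] := dP x.
have [|x rx kx] := exx (oroot o) (kids o) _ sz; first exact: wf_perm (olabE o) (wf_olab o).
exists x; have [rx' kx'] := dP x; apply: obj_inj; first by rewrite rx'.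
exact: perm_trans kx' kx.
Qed.

Definition rep_flag t (x : tri S * obj S) :=
  if t is Add t a b then rep t x.2 /\ rep_pair a b x.1 else False.

Lemma rep_flag_keq t t' x : keq Flag t t' -> rep_flag t x -> rep_flag t' x.
Proof.
move Ek: Flag => k tt'; elim: tt' Ek => {k t t'} //.
- by move=> k t u v _ IHt _ IHu Ek /(IHt Ek)/(IHu Ek).
- move=> k t a b t' a' b' tt' _ aa' _ bb' _ _ [to [oa [ob [aoa bob kab]]]].
  split; first exact: rep_keq to.
  by exists oa, ob; split=> //; [apply: rep_keq aoa|apply: rep_keq bob].
- by move=> k t a b _ [to /rep_pair_swap].
Qed.

(** S_X is the part of Z + S_X that has kids, whence the first condition on the image of [d]; the
    second is the disjointness of labels in a labeled product. *)
Lemma flag_model (T : Type) (lT : T -> seq L) (d : T -> tri S * obj S) :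
    injective d -> (forall x, perm_eq (tlab (d x).1 ++ olab (d x).2) (lT x)) ->
    (forall x, kids x.2 <> [::] /\ wf S (tlab x.1 ++ olab x.2) <-> exists y, d y = x) ->
  model Flag lT (fun t x => rep_flag t (d x)).
Proof.
move=> injd ld imd; split.
- by move=> t t' x; apply: rep_flag_keq.
- move=> [//|t a b] [//|t' a' b'] x [to abk] [t'o abk'].
  have tt' := rep_det to t'o.
  have [[aa bb]|[ab ba]] := rep_pair_det (fun o u => @rep_det a u o)
    (fun o u => @rep_det b u o) abk abk'; first exact: keq_cong.
  by apply: keq_trans (keq_swap _ _ _ _); apply: keq_cong.
- move=> [//|t a b] x x' [to abk] [to' abk']; apply: injd.
  have /= := rep_fun to to'; have := rep_pair_fun abk abk'.
  by case: (d x) (d x') => [? ?] [? ?] /= -> ->.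
- move=> x; have [t to] := rep_tot (d x).2.
  case Ec: (corners (d x).1) (size_corners (d x).1) => [|oa [|ob []]] // _.
  have [[a aoa] [b bob]] := (rep_tot oa, rep_tot ob).
  by exists (Add t a b); split=> //; exists oa, ob; rewrite Ec.
- move=> [//|t a b] vt /= w; have [o to] := rep_ex (wf_catl w).
  have [k abk] : exists k, rep_pair a b k.
    by apply: rep_pair_ex (wf_catr w) => u _; apply: rep_ex.
  have [+ _] := imd (k, o); case=> [|x Ex]; last by exists x; rewrite Ex.
  split=> /=; last first.
    by apply: wf_perm w; rewrite perm_catC perm_cat ?rep_lab ?rep_pair_lab.
  move=> Ek; move: vt (rep_kids to) => /=; rewrite Ek.
  by case: t {to w} => // -[].
- move=> [//|t a b] x [/rep_lab to /rep_pair_lab abk]; apply: perm_trans (ld x).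
  by rewrite /= perm_catC perm_cat.
- move=> [//|[l|//] a b] x [/rep_kids/= + _].
  have [_ /(_ (ex_intro _ _ erefl))[+ _]] := imd (d x).
  by case: (kids _).
Qed.

Definition rep_triangle t (s : seq (obj S)) :=
  if t is Add t a b then
    exists o oa ob, [/\ rep t o, rep a oa, rep b ob & perm_eq s [:: o; oa; ob]]
  else False.

Lemma rep_triangle_keq t t' s :
  keq Triangle t t' -> rep_triangle t s -> rep_triangle t' s.
Proof.
move Ek: Triangle => k tt'; elim: tt' Ek => {k t t'} //.
- by move=> k t u v _ IHt _ IHu Ek /(IHt Ek)/(IHu Ek).
- move=> k t a b t' a' b' tt' _ aa' _ bb' _ _ [o [oa [ob [to aoa bob kab]]]].
  by exists o, oa, ob; split=> //; [apply: rep_keq to|apply: rep_keq aoa|apply: rep_keq bob].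
- move=> k t a b _ [o [oa [ob [to aoa bob kab]]]].
  exists o, ob, oa; split=> //; apply: perm_trans kab _.
  by rewrite perm_cons (perm_catC [:: oa]).
- move=> t a b _ [o [oa [ob [to aoa bob kab]]]].
  exists ob, o, oa; split=> //; apply: perm_trans kab _.
  by rewrite (perm_catC [:: o; oa]).
Qed.

Lemma rep_triangle_det t t' s :
  rep_triangle t s -> rep_triangle t' s -> keq Triangle t t'.
Proof.
case: t t' => [//|t a b] [//|t' a' b'] [o [oa [ob [to aoa bob sab]]]].
(* The case where the roots of both trees carry the same corner [o]; the other cases reduce to it by
   rotating the second tree. *)
have det2 u c e oc oe : rep u o -> rep c oc -> rep e oe ->
    perm_eq s [:: o; oc; oe] -> keq Triangle (Add t a b) (Add u c e).
  move=> /(rep_det to) tu coc eoe; rewrite (permPl sab) perm_cons.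
  case/perm_pair=> -[Ea Eb]; subst.
    by apply: keq_cong => //; [apply: rep_det coc|apply: rep_det eoe].
  apply: keq_trans (keq_swap _ _ _ _).
  by apply: keq_cong => //; [apply: rep_det eoe|apply: rep_det coc].
move=> [o' [oa' [ob' [t'o aoa' bob' sab']]]].
have: o \in [:: o'; oa'; ob'] by rewrite -(perm_mem sab') (perm_mem sab) mem_head.
rewrite !inE => /or3P[]/eqP Eo; subst.
- exact: det2 sab'.
- apply: keq_trans (keq_rot _ _ _); apply: (det2 _ _ _ ob' o') => //.
  by rewrite (perm_trans sab') // (perm_catC [:: o']).
- apply: keq_trans (keq_sym (keq_rot _ _ _)); apply: (det2 _ _ _ o' oa') => //.
  by rewrite (perm_trans sab') // (perm_catC [:: o'; oa']).
Qed.

Lemma triangle_model (T : Type) (lT : T -> seq L) (d : T -> seq (obj S)) :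
    (forall x y, perm_eq (d x) (d y) -> x = y) ->
    (forall x, perm_eq (flatten (map (@olab L S) (d x))) (lT x)) ->
    (forall x, size (d x) = 3) ->
    (forall s, size s = 3 -> wf S (flatten (map (@olab L S) s)) ->
      exists x, perm_eq (d x) s) ->
  model Triangle lT (fun t x => rep_triangle t (d x)).
Proof.
move=> injd ld szd imd; split.
- by move=> t t' x; apply: rep_triangle_keq.
- by move=> t t' x; apply: rep_triangle_det.
- case=> [//|t a b] x x' [o [oa [ob [to aoa bob sab]]]] [o' [oa' [ob' [to' aoa' bob' sab']]]].
  apply: injd; rewrite (permPl sab) perm_sym (permPl sab').
  by rewrite (rep_fun to to') (rep_fun aoa aoa') (rep_fun bob bob').
- move=> x; case Ed: (d x) (szd x) => [|o [|oa [|ob []]]] // _.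
  have [t to] := rep_tot o; have [[a aoa] [b bob]] := (rep_tot oa, rep_tot ob).
  by exists (Add t a b), o, oa, ob.
- move=> [//|t a b] vt /= w; have [o to] := rep_ex (wf_catl w).
  have {}wab := wf_catr w; have [oa aoa] := rep_ex (wf_catl wab).
  have [ob bob] := rep_ex (wf_catr wab).
  have [//||x dx] := imd [:: o; oa; ob]; last by exists x, o, oa, ob.
  by apply: wf_perm w; rewrite /= cats0 !perm_cat // rep_lab.
- move=> [//|t a b] x [o [oa [ob [to aoa bob sab]]]]; apply: perm_trans (ld x).
  rewrite perm_sym (permPl (perm_flatten_map _ sab)) /= cats0 perm_sym.
  by rewrite !perm_cat // rep_lab.
- by move=> [//|t a b] x _; case: t.
Qed.

End SpecTheory.

(** * Graphs of decomposition trees *)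

Section TreeGraph.
Variable V : finType.
Implicit Types (t a b c : tree V) (x y z u v : V) (e : {set V}).

Definition triangle_edges x y z : {set {set V}} :=
  [set [set x; y]; [set x; z]; [set y; z]].

Lemma triangle_edgesC x y z : triangle_edges x y z = triangle_edges x z y.
Proof. by rewrite /triangle_edges (setUC [set z]) -setUA setUCA setUA. Qed.

Lemma triangle_edges_rot x y z : triangle_edges x y z = triangle_edges z x y.
Proof.
by rewrite /triangle_edges (setUC [set z] [set x]) (setUC [set z] [set y]) -setUA setUC.
Qed.

Lemma set2_eq x y u v :
  [set x; y] = [set u; v] -> (x = u /\ y = v) \/ (x = v /\ y = u).
Proof.
move=> E; have /set2P hx : x \in [set u; v] by rewrite -E set21.
have /set2P hy : y \in [set u; v] by rewrite -E set22.
have /set2P hu : u \in [set x; y] by rewrite E set21.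
have /set2P hv : v \in [set x; y] by rewrite E set22.
by case: hx hy hu hv => -> [] -> [] ? [] ?; subst; auto.
Qed.

Lemma mem_triangle_edges u v x y z : [set u; v] \in triangle_edges x y z ->
  (u = x /\ v = y) \/ (u = y /\ v = x) \/ (u = x /\ v = z) \/ (u = z /\ v = x) \/
  (u = y /\ v = z) \/ (u = z /\ v = y).
Proof. by rewrite !inE -orbA => /or3P[]/eqP/set2_eq; intuition. Qed.

Fixpoint gr t : {set {set V}} :=
  match t with
  | Leaf _ => set0
  | Add t a b =>
      triangle_edges (root t) (root a) (root b) :|: gr t :|: gr a :|: gr b
  end.

Lemma gr_Add t a b : gr (Add t a b) =
  triangle_edges (root t) (root a) (root b) :|: gr t :|: gr a :|: gr b.
Proof. by []. Qed.

Lemma in_gr_Add e t a b :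
  e \in gr (Add t a b) = [|| e \in triangle_edges (root t) (root a) (root b),
    e \in gr t, e \in gr a | e \in gr b].
Proof. by rewrite gr_Add 3!in_setU -!orbA. Qed.

Lemma in_gr_Leaf e x : (e \in gr (Leaf x)) = false.
Proof. by rewrite inE. Qed.

Arguments gr : simpl never.

(* An incidence (triangle, vertex) is marked by the edge opposite to the vertex. *)
Definition mark k t : {set V} :=
  match k, t with
  | Vertex, _ => [set root t]
  | Flag, Add _ a b => [set root a; root b]
  | Triangle, Add t a b => [set root t; root a; root b]
  | _, Leaf _ => set0
  end.

Lemma keq_root t t' : keq Vertex t t' -> root t = root t'.
Proof.
move Ek: Vertex => k tt'; elim: tt' Ek => {k t t'} //=.
- by move=> k t u v _ IHt _ IHu Ek; rewrite IHt // IHu.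
- by move=> k t a b t' a' b' _ IHt _ _ _ _ _; rewrite IHt.
Qed.

Lemma keq_gr k t t' : keq k t t' -> gr t = gr t'.
Proof.
elim=> {k t t'} //.
- by move=> k t u v _ -> _ ->.
- by move=> k t a b t' a' b' /keq_root rt E /keq_root ra Ea /keq_root rb Eb;
    apply/setP=> e; rewrite !in_gr_Add rt E ra Ea rb Eb.
- move=> k t a b; apply/setP=> e; rewrite !in_gr_Add triangle_edgesC.
  by congr (_ || (_ || _)); rewrite orbC.
- move=> t a b c d; apply/setP=> e; rewrite !in_gr_Add /=.
  move: (e \in triangle_edges _ _ _) (e \in triangle_edges _ _ _) (e \in gr t)
    (e \in gr a) (e \in gr b) (e \in gr c) (e \in gr d).
  by do 7!case.
- move=> t a b; apply/setP=> e; rewrite !in_gr_Add triangle_edges_rot.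
  by congr (_ || _); rewrite orbA orbC.
Qed.

Lemma keq_mark k t t' : keq k t t' -> mark k t = mark k t'.
Proof.
elim=> {k t t'} //=.
- by move=> k t u v _ -> _ ->.
- by move=> [] t a b t' a' b' /= /keq_root-> _ /keq_root-> _ /keq_root-> _.
- by move=> [] t a b //=; [rewrite setUC|rewrite setUAC].
- by move=> t a b; rewrite setUC setUA.
Qed.

Lemma gr_sub t e x : e \in gr t -> x \in e -> x \in lab t.
Proof.
elim: t e => [l|t IHt a IHa b IHb] e /=; first by rewrite in_gr_Leaf.
rewrite in_gr_Add !mem_cat => /or4P[+|et|ea|eb] xe; last 3 first.
- by rewrite (IHt _ et xe).
- by rewrite (IHa _ ea xe) orbT.
- by rewrite (IHb _ eb xe) !orbT.
move: xe; rewrite !inE -orbA => + /or3P[]/eqP Ee; rewrite Ee !inE => /orP[]/eqP->;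
  by rewrite mem_root ?orbT.
Qed.

Lemma gr_ind t (P : V -> Prop) : P (root t) ->
    (forall x y, x \in lab t -> P x -> [set x; y] \in gr t -> P y) ->
  forall x, x \in lab t -> P x.
Proof.
elim: t => [l|t IHt a IHa b IHb] /= Pr IP x; first by rewrite inE => /eqP->.
have Pa : P (root a).
  by apply: IP Pr _; rewrite ?mem_cat ?mem_root // in_gr_Add !inE eqxx.
have Pb : P (root b).
  by apply: IP Pr _; rewrite ?mem_cat ?mem_root // in_gr_Add !inE eqxx ?orbT.
rewrite !mem_cat => /or3P[]; [apply: IHt|apply: IHa|apply: IHb] => // u v ul Pu uv;
  by apply: IP Pu _; rewrite ?mem_cat ?ul ?orbT // in_gr_Add uv ?orbT.
Qed.

Lemma uniq_Add t a b : uniq (lab (Add t a b)) ->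
  [/\ uniq (lab t), uniq (lab a), uniq (lab b)
    & forall x, [/\ x \in lab t -> x \notin lab a, x \in lab t -> x \notin lab b
                 & x \in lab a -> x \notin lab b]].
Proof.
rewrite /= !cat_uniq has_cat negb_or => /and3P[-> /andP[hta htb] /and3P[-> hab ->]].
split=> // x; split=> xl; apply/negP=> xl'.
- by case/hasP: hta; exists x.
- by case/hasP: htb; exists x.
- by case/hasP: hab; exists x.
Qed.

Lemma keq_uniq k t t' : keq k t t' -> uniq (lab t) = uniq (lab t').
Proof. by move/keq_lab/perm_uniq. Qed.

Lemma root_neq t a b : uniq (lab (Add t a b)) ->
  [/\ root t != root a, root t != root b & root a != root b].
Proof.
case/uniq_Add=> _ _ _ d; have := (mem_root t, mem_root a, mem_root b) => -[[rt ra] rb].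
by split; apply/eqP=> E; [have [h _ _] := d (root t)|have [_ h _] := d (root t)
  |have [_ _ h] := d (root a)]; move: h; rewrite ?rt ?ra E ?ra ?rb => /(_ isT).
Qed.

Lemma gr_pair t e : uniq (lab t) -> e \in gr t -> exists x y, x != y /\ e = [set x; y].
Proof.
elim: t e => [l|t IHt a IHa b IHb] e; first by rewrite in_gr_Leaf.
move=> u; have [ta tb ab] := root_neq u; have [ut ua ub _] := uniq_Add u.
rewrite in_gr_Add => /or4P[|/IHt|/IHa|/IHb]; try exact.
by rewrite !inE -orbA => /or3P[]/eqP->; do 2!eexists; split; try reflexivity.
Qed.

Lemma gr_neq t x y : uniq (lab t) -> [set x; y] \in gr t -> x != y.
Proof.
move=> u /(gr_pair u)[x' [y' [n]]] /set2_eq[][-> ->] //.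
by rewrite eq_sym.
Qed.

Lemma gr_Add_adj t a b x y : uniq (lab (Add t a b)) -> x \in lab t ->
    [set x; y] \in gr (Add t a b) ->
  [set x; y] \in gr t \/ x = root t /\ (y = root a \/ y = root b).
Proof.
case/uniq_Add=> _ _ _ d xt; have [xa xb _] := d x.
rewrite in_gr_Add => /or4P[|->|/gr_sub/(_ (set21 _ _))|/gr_sub/(_ (set21 _ _))];
  [|by left|by rewrite (negPf (xa xt))|by rewrite (negPf (xb xt))].
have na : x <> root a by move=> E; move: (xa xt); rewrite E mem_root.
have nb : x <> root b by move=> E; move: (xb xt); rewrite E mem_root.
by move/mem_triangle_edges; intuition.
Qed.

(** A neighbour of [root t] other than the corners lies in [lab t], and a neighbour of [root a]
    other than the corners lies in [lab a]; these are disjoint, so the only common neighbour is the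
    third corner. *)
Lemma triangle_third t a b z : uniq (lab (Add t a b)) ->
    [set root t; z] \in gr (Add t a b) -> [set root a; z] \in gr (Add t a b) ->
  z = root b.
Proof.
move=> u tz az; have [ut _ _ d] := uniq_Add u.
have k1: keq Triangle (Add t a b) (Add a t b).
  by apply: keq_trans (keq_rot _ _ _) _; apply: keq_trans (keq_rot _ _ _) (keq_swap _ _ _ _).
have uk: uniq (lab (Add a t b)) by rewrite -(keq_uniq k1).
have zt := gr_neq u tz; have za := gr_neq u az.
move: az; rewrite (keq_gr k1) => /(gr_Add_adj uk (mem_root _)) az.
have {tz} := gr_Add_adj u (mem_root _) tz.
case: az => [/gr_sub/(_ (set22 _ _)) zla|[_ [Ez|//]]]; last by rewrite Ez eqxx in zt.
case=> [/gr_sub/(_ (set22 _ _)) zlt|[_ [Ez|//]]]; last by rewrite Ez eqxx in za.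
by have [/(_ zlt)] := d z; rewrite zla.
Qed.

(** Graph counterpart of [rep_extract]: the triangle on a given edge at the root can be brought to
    the top. *)
Lemma gr_extract t u : uniq (lab t) -> [set root t; u] \in gr t ->
  exists t1 a b, keq Vertex t (Add t1 a b) /\ root a = u.
Proof.
elim: t => [l|t IHt a _ b _] ul /=; first by rewrite in_gr_Leaf.
have [ut _ _ _] := uniq_Add ul.
case/(gr_Add_adj ul (mem_root _)) => [/(IHt ut)[t1 [a1 [b1 [tt1 <-]]]]|[_ [->|->]]].
- exists (Add t1 a b), a1, b1; split=> //.
  apply: keq_trans (keq_exchange _ _ _ _ _).
  by apply: keq_cong => //; apply: keq_refl.
- by exists t, a, b; split=> //; apply: keq_refl.
- by exists t, b, a; split=> //; apply: keq_swap.
Qed.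

Section SameRoots.
Variables (t a b t' a' b' : tree V).
Hypotheses (u : uniq (lab (Add t a b))) (u' : uniq (lab (Add t' a' b'))).
Hypotheses (E : gr (Add t a b) = gr (Add t' a' b')).
Hypotheses (rt : root t = root t') (ra : root a = root a') (rb : root b = root b').

(** Walk inside [t] from its root. Each vertex met lies in [lab t], hence differs from [root a] and
    [root b], which are the only exits from [t'] in the second tree. *)
Lemma sub_lab_part : {subset lab t <= lab t'}.
Proof.
have [_ _ _ d] := uniq_Add u.
apply: gr_ind => [|x y xt xt' xy]; first by rewrite rt mem_root.
have: [set x; y] \in gr (Add t' a' b') by rewrite -E in_gr_Add xy ?orbT.
case/(gr_Add_adj u' xt') => [/gr_sub/(_ (set22 _ _)) //|].
have yt := gr_sub xy (set22 _ _).
rewrite -ra -rb; case=> _ [Ey|Ey]; have [ya yb _] := d y.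
  by move: (ya yt); rewrite Ey mem_root.
by move: (yb yt); rewrite Ey mem_root.
Qed.

End SameRoots.

Lemma gr_part t a b t' a' b' : uniq (lab (Add t a b)) -> uniq (lab (Add t' a' b')) ->
    gr (Add t a b) = gr (Add t' a' b') ->
    root t = root t' -> root a = root a' -> root b = root b' ->
  gr t = gr t'.
Proof.
have sub t0 a0 b0 t1 a1 b1 : uniq (lab (Add t0 a0 b0)) -> uniq (lab (Add t1 a1 b1)) ->
    gr (Add t0 a0 b0) = gr (Add t1 a1 b1) ->
    root t0 = root t1 -> root a0 = root a1 -> root b0 = root b1 -> gr t0 \subset gr t1.
  move=> u0 u1 E rt ra rb; apply/subsetP=> e et; have [ut _ _ d] := uniq_Add u0.
  have [x [y [_ Ee]]] := gr_pair ut et; move: et; rewrite {}Ee => et.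
  have xt := gr_sub et (set21 _ _).
  have xt1 := sub_lab_part u0 u1 E rt ra rb xt.
  have: [set x; y] \in gr (Add t1 a1 b1) by rewrite -E in_gr_Add et ?orbT.
  case/(gr_Add_adj u1 xt1) => //; rewrite -ra -rb; have yt := gr_sub et (set22 _ _).
  case=> _ [Ey|Ey]; have [ya yb _] := d y.
    by move: (ya yt); rewrite Ey mem_root.
  by move: (yb yt); rewrite Ey mem_root.
move=> u u' E rt ra rb; apply/eqP; rewrite eqEsubset.
by rewrite (sub _ _ _ _ _ _ u u') // (sub _ _ _ _ _ _ u' u).
Qed.

Lemma gr_parts t a b t' a' b' : uniq (lab (Add t a b)) -> uniq (lab (Add t' a' b')) ->
    gr (Add t a b) = gr (Add t' a' b') ->
    root t = root t' -> root a = root a' -> root b = root b' ->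
  [/\ gr t = gr t', gr a = gr a' & gr b = gr b'].
Proof.
move=> u u' E rt ra rb.
have [k1 k2] := (keq_rotr t a b, keq_rotr t' a' b').
have [k3 k4] := (keq_rot t a b, keq_rot t' a' b').
split; first exact: (gr_part u u').
- apply: (@gr_part a b t a' b' t') => //; first by rewrite -(keq_uniq k1).
    by rewrite -(keq_uniq k2).
  by rewrite -(keq_gr k1) -(keq_gr k2).
- apply: (@gr_part b t a b' t' a') => //; first by rewrite -(keq_uniq k3).
    by rewrite -(keq_uniq k4).
  by rewrite -(keq_gr k3) -(keq_gr k4).
Qed.

(** Counterpart of [rep_det]: once the edge from the root to [root a] is brought to the top of [t'],
    the third corner is forced, and then so are the graphs of the three parts. *)
Lemma gr_root_det t t' : uniq (lab t) -> uniq (lab t') ->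
  gr t = gr t' -> root t = root t' -> keq Vertex t t'.
Proof.
elim: t t' => [l|t IHt a IHa b IHb] t' u u' E rt.
  case: t' u' E rt => [l'|t' a' b'] _ E /= rt; first by rewrite rt; apply: keq_refl.
  by move/setP/(_ [set root t'; root a']): E; rewrite in_gr_Add in_gr_Leaf !inE eqxx.
have: [set root t'; root a] \in gr t' by rewrite -E -rt in_gr_Add !inE eqxx.
case/(gr_extract u')=> t1 [a1 [b1 [k1 ra]]].
have u1 : uniq (lab (Add t1 a1 b1)) by rewrite -(keq_uniq k1).
have rt1 : root t = root t1 by rewrite -[root t]/(root (Add t a b)) rt (keq_root k1).
have E1 : gr (Add t a b) = gr (Add t1 a1 b1) by rewrite E (keq_gr k1).
have rb : root b = root b1.
  by apply: (triangle_third u1); rewrite -E1 -?rt1 ?ra in_gr_Add !inE eqxx ?orbT.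
have [gt ga gb] := gr_parts u u1 E1 rt1 (esym ra) rb.
have [[ut ua ub _] [ut1 ua1 ub1 _]] := (uniq_Add u, uniq_Add u1).
by apply: keq_trans (keq_sym k1); apply: keq_cong; auto.
Qed.

Lemma gr_roots_det k t a b t' a' b' : uniq (lab (Add t a b)) -> uniq (lab (Add t' a' b')) ->
    gr (Add t a b) = gr (Add t' a' b') ->
    root t = root t' -> root a = root a' -> root b = root b' ->
  keq k (Add t a b) (Add t' a' b').
Proof.
move=> u u' E rt ra rb; have [gt ga gb] := gr_parts u u' E rt ra rb.
have [[ut ua ub _] [ut1 ua1 ub1 _]] := (uniq_Add u, uniq_Add u').
by apply: keq_cong; apply: gr_root_det.
Qed.

(** Everything reduces to equal corners in equal positions. For [Flag] the swap aligns the marked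
    edge, and the root is its unique common neighbour; for [Triangle] a rotation aligns the roots,
    then possibly a swap the other corners. *)
Lemma gr_mark_det k t t' : uniq (lab t) -> uniq (lab t') ->
  valid Triangle t -> valid Triangle t' -> gr t = gr t' -> mark k t = mark k t' -> keq k t t'.
Proof.
case: k => /= u u' vt vt' E.
- by move=> /(congr1 (fun A : {set V} => root t \in A)); rewrite !inE eqxx => /esym/eqP;
    apply: gr_root_det.
- case: t u vt E => [l|t a b] u vt E //.
  case: t' u' vt' E => [|t' a' b'] u' vt' E //= M.
  wlog [ra rb] : a' b' u' E vt' M / root a = root a' /\ root b = root b'.
    case/set2_eq: (M) => [|[ra rb]] // H; first by apply.
    apply: keq_trans (keq_swap _ _ _ _); apply: H => //.
    + by rewrite -(keq_uniq (keq_swap Flag _ _ _)).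
    + by rewrite E (keq_gr (keq_swap Flag _ _ _)).
    + by rewrite M setUC.
  apply: gr_roots_det => //.
  have kr := keq_rotr t' a' b'.
  apply/(triangle_third (t := a') (a := b') (b := t')); first by rewrite -(keq_uniq kr).
    by rewrite -(keq_gr kr) -E -ra setUC in_gr_Add !inE eqxx ?orbT.
  by rewrite -(keq_gr kr) -E -rb setUC in_gr_Add !inE eqxx ?orbT.
- case: t u vt E => [l|t a b] u vt E //.
  case: t' u' vt' E => [|t' a' b'] u' vt' E //= M.
  wlog rt : t' a' b' u' E {vt'} M / root t = root t'.
    have: root t \in [set root t'; root a'; root b'] by rewrite -M !inE eqxx.
    rewrite !inE -orbA => /or3P[]/eqP rt H; first exact: H.
      have kr := keq_rotr t' a' b'.
      apply: keq_trans (keq_sym kr); apply: H => //.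
      * by rewrite -(keq_uniq kr).
      * by rewrite E (keq_gr kr).
      * by rewrite M; apply: (keq_mark kr).
    have kr := keq_rot t' a' b'.
    apply: keq_trans (keq_sym kr); apply: H => //.
    * by rewrite -(keq_uniq kr).
    * by rewrite E (keq_gr kr).
    * by rewrite M; apply: (keq_mark kr).
  have [ta tb ab] := root_neq u; have [ta' tb' ab'] := root_neq u'.
  have: [set root a; root b] = [set root a'; root b'].
    apply/setP=> x; move/setP/(_ x): M; rewrite !inE -rt.
    case: eqVneq => [->|] //= _.
    by rewrite (negPf ta) (negPf tb) rt (negPf ta') (negPf tb').
  case/set2_eq=> -[ra rb]; first exact: gr_roots_det.
  apply: keq_trans (keq_swap _ _ _ _); apply: gr_roots_det => //.
    by rewrite -(keq_uniq (keq_swap Flag _ _ _)).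
  by rewrite E (keq_gr (keq_swap Flag _ _ _)).
Qed.

End TreeGraph.

Arguments gr {V} t : simpl never.

(** * Local characterization of cacti *)

Section LocalCactus.
Variable V : finType.
Implicit Types (t a b : tree V) (x y z u v w : V) (e W : {set V}) (E : {set {set V}}).

Lemma adj_sym E : symmetric (adj E).
Proof. by move=> x y; rewrite /adj setUC. Qed.

Lemma connect_ind E (P : V -> Prop) x y : P x ->
    (forall u v, P u -> [set u; v] \in E -> P v) -> connect (adj E) x y -> P y.
Proof.
move=> Px IP /connectP[p + ->] {y}.
by elim: p x Px => //= y p IHp x Px /andP[xy]; apply: IHp; apply: IP xy.
Qed.

(* The coloring c witnesses that x, y and z are pairwise disconnected once the
   edges of the triangle are removed. *)
Definition separated_triangle E x y z :=
  [/\ [set x; y] \in E, [set x; z] \in E, [set y; z] \in E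
    & exists c : V -> V, [/\ c x != c y, c x != c z, c y != c z
      & forall u v, [set u; v] \in E -> [set u; v] \notin triangle_edges x y z ->
          c u = c v]].

(** The cactus condition without cycles: it passes to the components left by a triangle, as an
    induction requires. *)
Definition locally_cactus E := forall e, e \in E ->
  exists x y z, e = [set x; y] /\ separated_triangle E x y z.

Lemma separated_swap E x y z : separated_triangle E x y z -> separated_triangle E x z y.
Proof.
case=> xy xz yz [c [cxy cxz cyz sep]]; split; rewrite // 1?setUC //.
by exists c; split; rewrite // 1?eq_sym // triangle_edgesC.
Qed.

Lemma separated_rot E x y z : separated_triangle E x y z -> separated_triangle E z x y.
Proof.
case=> xy xz yz [c [cxy cxz cyz sep]]; split; rewrite // 1?setUC //.
by exists c; split; rewrite // 1?eq_sym // -triangle_edges_rot.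
Qed.

(** Whatever hangs outside [t] is attached at [root t], so it receives the colour of [root t]. *)
Lemma separated_extend t a b x y z : uniq (lab (Add t a b)) ->
  separated_triangle (gr t) x y z -> separated_triangle (gr (Add t a b)) x y z.
Proof.
move=> u [xy xz yz [c [cxy cxz cyz sep]]]; have [_ _ _ d] := uniq_Add u.
split; rewrite ?in_gr_Add ?xy ?xz ?yz ?orbT //.
have [[xt yt] zt] := (gr_sub xy (set21 _ _), gr_sub xy (set22 _ _), gr_sub yz (set22 _ _)).
exists (fun v => if v \in lab t then c v else c (root t)); rewrite xt yt zt; split=> //.
have nt v : v \in lab a \/ v \in lab b -> (v \in lab t) = false.
  by have [ta tb _] := d v; case=> vl; apply/negP => /[dup] /ta + /tb; rewrite vl.
move=> v w; rewrite in_gr_Add => /or4P[|vw|vw|vw].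
- have na := nt _ (or_introl (mem_root a)); have nb := nt _ (or_intror (mem_root b)).
  by case/mem_triangle_edges=> [|[|[|[|[|]]]]] [-> ->]; rewrite ?na ?nb ?mem_root.
- by rewrite (gr_sub vw (set21 _ _)) (gr_sub vw (set22 _ _)); apply: sep.
- by rewrite !nt //; left; [apply: gr_sub vw (set22 _ _)|apply: gr_sub vw (set21 _ _)].
- by rewrite !nt //; right; [apply: gr_sub vw (set22 _ _)|apply: gr_sub vw (set21 _ _)].
Qed.

Lemma separated_root t a b : uniq (lab (Add t a b)) ->
  separated_triangle (gr (Add t a b)) (root t) (root a) (root b).
Proof.
move=> u; have [rta rtb rab] := root_neq u; have [_ _ _ d] := uniq_Add u.
split; rewrite ?in_gr_Add ?inE ?eqxx ?orbT //.
pose c v := if v \in lab t then root t else if v \in lab a then root a else root b.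
have ct v : v \in lab t -> c v = root t by rewrite /c => ->.
have ca v : v \in lab a -> c v = root a.
  by have [ta _ _] := d v; rewrite /c; case: ifP => [/ta/negPf->|_ ->].
have cb v : v \in lab b -> c v = root b.
  move=> vb; have [_ tb ab] := d v; rewrite /c; case: ifP => [/tb|_]; first by rewrite vb.
  by case: ifP => // /ab; rewrite vb.
exists c; rewrite (ct _ (mem_root t)) (ca _ (mem_root a)) (cb _ (mem_root b)); split=> //.
move=> v w; rewrite in_gr_Add => /or4P[->//|vw|vw|vw] _.
- by rewrite !ct ?(gr_sub vw (set21 _ _)) ?(gr_sub vw (set22 _ _)).
- by rewrite !ca ?(gr_sub vw (set21 _ _)) ?(gr_sub vw (set22 _ _)).
- by rewrite !cb ?(gr_sub vw (set21 _ _)) ?(gr_sub vw (set22 _ _)).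
Qed.

Lemma gr_locally_cactus t : uniq (lab t) -> locally_cactus (gr t).
Proof.
elim: t => [l|t IHt a IHa b IHb] u e; first by rewrite in_gr_Leaf.
have [ut ua ub _] := uniq_Add u; rewrite in_gr_Add => /or4P[|et|ea|eb].
- have sep := separated_root u.
  rewrite !inE -orbA => /or3P[]/eqP->; do 3!eexists; split; try reflexivity; first exact: sep.
    exact: separated_swap sep.
  exact: separated_rot (separated_rot sep).
- have [x [y [z [-> sep]]]] := IHt ut e et.
  by exists x, y, z; split=> //; apply: separated_extend.
- have [x [y [z [-> sep]]]] := IHa ua e ea; exists x, y, z; split=> //.
  have kr := keq_rotr t a b.
  rewrite (keq_gr kr).
  by apply: separated_extend; rewrite // -(keq_uniq kr).
- have [x [y [z [-> sep]]]] := IHb ub e eb; exists x, y, z; split=> //.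
  have kr := keq_rot t a b.
  rewrite (keq_gr kr).
  by apply: separated_extend; rewrite // -(keq_uniq kr).
Qed.

(* Induction on #|W|: the three color classes of a triangle at r are again
   locally cacti. *)
Lemma locally_cactus_tree W E r : r \in W -> (forall e, e \in E -> e \subset W) ->
    (forall w, w \in W -> connect (adj E) r w) -> locally_cactus E ->
  exists t, [/\ uniq (lab t), lab t =i W, gr t = E & root t = r].
Proof.
have [m] := ubnP #|W|; elim: m W E r => // m IHm W E r leWm rW subE connE lcE.
have [E0|[e eE]] := set_0Vmem E.
  exists (Leaf r); split=> // w; rewrite inE; apply/eqP/idP=> [->//|/connE].
  by apply: (connect_ind (P := eq^~ r)) => // u v _; rewrite E0 inE.
have [u ruE] : exists u, [set r; u] \in E.
  have [x [y [_ [Ee [xyE _ _ _]]]]] := lcE e eE.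
  have /connectP[[|u p] /= + Ex] : connect (adj E) r x.
    by apply/connE/(subsetP (subE e eE)); rewrite Ee set21.
    by exists y; rewrite -Ex.
  by case/andP=> ru _; exists u.
have [z sep] : exists z, separated_triangle E r u z.
  have [x [y [z [/set2_eq[][-> ->] sep]]]] := lcE _ ruE; exists z => //.
  exact: separated_rot (separated_swap sep).
case: sep => _ rzE uzE [c [cru crz cuz sep]].
pose tc := [:: r; u; z].
pose Wp i := [set w in W | c w == c i]; pose Ep i := [set e' in E | e' \subset Wp i].
have tcW i : i \in tc -> i \in W.
  rewrite !inE => /or3P[]/eqP-> //.
    by apply: (subsetP (subE _ ruE)); rewrite set22.
  by apply: (subsetP (subE _ rzE)); rewrite set22.
have injc i j : i \in tc -> j \in tc -> c i = c j -> i = j.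
  move: cru crz cuz; rewrite !inE => /eqP ? /eqP ? /eqP ?.
  by do 2![case/or3P=> /eqP->] => // E1; exfalso; congruence.
have EW x y : [set x; y] \in E -> x \in W /\ y \in W.
  by move=> xy; split; apply: (subsetP (subE _ xy)); rewrite ?set21 ?set22.
have tri_tc x y : [set x; y] \in triangle_edges r u z -> x \in tc /\ y \in tc.
  by case/mem_triangle_edges=> [|[|[|[|[|]]]]] [-> ->]; rewrite !inE !eqxx ?orbT.
have EpP i x y : x \in Wp i -> y \in Wp i -> [set x; y] \in E -> [set x; y] \in Ep i.
  by move=> xi yi xy; rewrite inE xy; apply/subsetP=> v /set2P[]->.
(* A walk from [r] is restarted at each corner reached through an edge of the central triangle; the
   last stretch stays within one colour class. *)
pose covered w := exists i, [/\ i \in tc, c w = c i & connect (adj (Ep i)) i w].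
have cover w : w \in W -> covered w.
  move/connE; apply: (connect_ind (P := covered)); first by exists r; rewrite inE eqxx.
  move=> x y [i [itc cx ix]] xy.
  have [/tri_tc[_ ytc]|ntri] := boolP ([set x; y] \in triangle_edges r u z).
    by exists y; split.
  have cy := sep _ _ xy ntri; exists i; split; rewrite -?cy //.
  apply: connect_trans ix (connect1 _); have [xW yW] := EW x y xy.
  by apply: EpP; rewrite // inE ?xW ?yW /= -?cy cx.
(* The corner [j] lies in [W] but outside the class of [i], so that class is strictly smaller. *)
have part i j : i \in tc -> j \in tc -> c i != c j ->
    exists t, [/\ uniq (lab t), lab t =i Wp i, gr t = Ep i & root t = i].
  move=> itc jtc cij; apply: IHm.
  - apply: (@leq_trans #|W|) => //; apply/proper_card/properP; split.
      by apply/subsetP=> w; rewrite inE => /andP[].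
    by exists j; rewrite ?inE ?tcW // eq_sym negb_and cij orbT.
  - by rewrite inE tcW /=.
  - by move=> e'; rewrite inE => /andP[].
  - move=> w; rewrite inE => /andP[/cover[k [ktc -> ik]] /eqP/injc <-] //.
  move=> e'; rewrite inE => /andP[/lcE[x [y [z' [-> [xy xz yz [c' [c1 c2 c3 sep']]]]]]] sub].
  have xi : x \in Wp i by apply: (subsetP sub); rewrite set21.
  have yi : y \in Wp i by apply: (subsetP sub); rewrite set22.
  exists x, y, z'; split=> //.
  have tci v : v \in Wp i -> v \in tc -> v = i.
    by rewrite inE => /andP[_ /eqP cv] vtc; apply: injc.
  (* An edge from [x] or [y] to [z'] outside the central triangle carries the colour over to [z'].
     If both edges were in it, [x] and [y] would both be the only corner of this colour, against
     [c' x != c' y]. *)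
  have zi : z' \in Wp i.
    have [_ zW] := EW _ _ xz; rewrite inE zW /=.
    move: (xi) (yi); rewrite !inE => /andP[_ /eqP cx] /andP[_ /eqP cy].
    have [/tri_tc[xtc _]|/(sep _ _ xz)<-] := boolP ([set x; z'] \in triangle_edges r u z);
      last by rewrite cx.
    have [/tri_tc[ytc _]|/(sep _ _ yz)<-] := boolP ([set y; z'] \in triangle_edges r u z);
      last by rewrite cy.
    by move: c1; rewrite (tci x) // (tci y) // eqxx.
  split; try exact: EpP.
  by exists c'; split=> // v w; rewrite inE => /andP[vw _]; apply: sep'.
have [rtc [utc ztc]] : r \in tc /\ u \in tc /\ z \in tc.
  by rewrite !inE !eqxx !orbT.
have [tr [utr ltr gtr rtr]] := part r u rtc utc cru.
have [tu [utu ltu gtu rtu]] := part u z utc ztc cuz.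
have [|tz [utz ltz gtz rtz]] := part z r ztc rtc; first by rewrite eq_sym.
exists (Add tr tu tz); split=> //.
- have disj ti tj i j : lab ti =i Wp i -> lab tj =i Wp j -> c i != c j ->
      has [in lab ti] (lab tj) = false.
    move=> li lj /negPf cij; apply/negbTE/hasPn=> w; rewrite lj !inE li inE.
    by case/andP=> _ /eqP->; rewrite eq_sym cij andbF.
  rewrite /= !cat_uniq utr utu utz has_cat (disj _ _ r u) // (disj _ _ r z) //.
  by rewrite (disj _ _ u z).
- move=> w; rewrite /= !mem_cat ltr ltu ltz !inE -!andb_orr.
  case wW: (w \in W) => //=; have [i [+ -> _]] := cover w wW.
  by rewrite !inE => /or3P[]/eqP->; rewrite eqxx ?orbT.
- apply/setP=> e'; rewrite in_gr_Add rtr rtu rtz gtr gtu gtz; apply/idP/idP.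
    rewrite !inE -!orbA.
    by case/or4P=> [/eqP->|/eqP->|/eqP->|/or3P[]/andP[]].
  move=> e'E; have [x [y [_ [Ee' _]]]] := lcE e' e'E.
  rewrite {e'}Ee' in e'E *; have [xW yW] := EW _ _ e'E.
  case: (boolP ([set x; y] \in triangle_edges r u z)) => //= ntri.
  have [i [itc cx _]] := cover x xW; have cy := sep _ _ e'E ntri.
  have: [set x; y] \in Ep i by apply: EpP; rewrite // inE ?xW ?yW -?cy cx eqxx.
  by move: itc; rewrite !inE => /or3P[]/eqP-> ->; rewrite ?orbT.
Qed.

End LocalCactus.

(** * Equivalence of the cycle condition with the separation of triangles *)

Section Cycles.
Variable V : finType.
Implicit Types (x y z u v w : V) (e : {set V}) (E F : {set {set V}}) (c p : seq V).

Lemma cycle_edges_triangle x y z :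
  uniq [:: x; y; z] -> cycle_edges [:: x; y; z] = triangle_edges x y z.
Proof.
rewrite /= !inE negb_or andbT => /andP[/andP[/negPf xy /negPf xz] /negPf yz].
have nx : next [:: x; y; z] x = y by rewrite /= eqxx.
have ny : next [:: x; y; z] y = z by rewrite /= eqxx eq_sym xy.
have nz : next [:: x; y; z] z = x by rewrite /= eqxx ![z == _]eq_sym xz yz.
apply/setP=> e; rewrite !inE -orbA; apply/imsetP/or3P.
  case=> u; rewrite !inE => /or3P[]/eqP-> ->; rewrite ?nx ?ny ?nz.
  - by constructor 1.
  - by constructor 3.
  - by rewrite setUC; constructor 2.
case=> /eqP->.
- by exists x; rewrite ?nx ?mem_head.
- by exists z; rewrite ?nz 1?setUC // !inE eqxx !orbT.
- by exists y; rewrite ?ny // !inE eqxx !orbT.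
Qed.

Lemma cycle_edges_rot c n : uniq c -> cycle_edges (rot n c) = cycle_edges c.
Proof.
move=> uc; apply/setP=> e; apply/imsetP/imsetP=> -[x xc ->]; exists x;
  by rewrite ?next_rot ?mem_rot // -(mem_rot n).
Qed.

Lemma cycle_edges_cons E c e : 2 < size c -> ucycle (adj E) c -> e \in cycle_edges c ->
  exists x y z p, [/\ e = [set x; y], cycle_edges c = cycle_edges [:: x, y, z & p]
    & ucycle (adj E) [:: x, y, z & p]].
Proof.
move=> szc ucc /imsetP[x xc ->]; have [cc uc] := andP ucc.
have [i s Es] := rot_to xc; case: s Es => [|y [|z p]] Es.
- by rewrite -(size_rot i) Es in szc.
- by rewrite -(size_rot i) Es in szc.
exists x, y, z, p; split.
- by rewrite -(next_rot i uc) Es /= eqxx.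
- by rewrite -(cycle_edges_rot i uc) Es.
- by rewrite -Es /ucycle rot_cycle rot_uniq.
Qed.

Lemma graph_cycle_triangle E x y z : uniq [:: x; y; z] ->
  [set x; y] \in E -> [set x; z] \in E -> [set y; z] \in E ->
  graph_cycle E (triangle_edges x y z).
Proof.
move=> u xy xz yz; exists [:: x; y; z]; split; rewrite ?cycle_edges_triangle //.
by rewrite /ucycle u /= /adj xy yz setUC xz.
Qed.

Lemma card_triangle_edges x y z : uniq [:: x; y; z] -> #|triangle_edges x y z| = 3.
Proof.
rewrite /= !inE negb_or andbT => /andP[/andP[xy xz] yz].
have n1 : [set x; y] != [set x; z].
  by apply/eqP=> /set2_eq[][]; move/eqP: xy; move/eqP: yz; congruence.
have n2 : [set x; y] != [set y; z].
  by apply/eqP=> /set2_eq[][]; move/eqP: xy; move/eqP: xz; congruence.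
have n3 : [set x; z] != [set y; z].
  by apply/eqP=> /set2_eq[][]; move/eqP: xy; move/eqP: xz; congruence.
by rewrite /triangle_edges -setUA !cardsU1 cards1 !inE negb_or n1 n2 n3.
Qed.

Lemma separated_uniq E x y z : separated_triangle E x y z -> uniq [:: x; y; z].
Proof.
case=> _ _ _ [c [cxy cxz cyz _]].
have n v w : c v != c w -> v != w by apply: contra_neq => ->.
by rewrite /= !inE negb_or (n _ _ cxy) (n _ _ cxz) (n _ _ cyz).
Qed.

(** List the cycle as [x], [y], [z'] and so on. If [z'] is not [z], the cycle continues in the
    colour of [y] without meeting [y] again; if [z'] is [z] and a further vertex follows, it
    continues in the colour of [z] without meeting [z] again. In both cases it cannot come back to
    [x], which has another colour. *)
Lemma separated_cycle E x y z F : separated_triangle E x y z ->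
  graph_cycle E F -> [set x; y] \in F -> F = triangle_edges x y z.
Proof.
move=> sep [c [szc ucc ->]] /(cycle_edges_cons szc ucc)[x' [y' [z' [p [Exy -> {c szc ucc}]]]]].
wlog [? ?] : x y sep Exy / x' = x /\ y' = y.
  case/set2_eq: (Exy) => -[? ?] H; subst x' y'; first by apply: H.
  rewrite triangle_edgesC triangle_edges_rot; apply: H; rewrite 1?setUC //.
  exact: separated_rot (separated_swap sep).
subst x' y'; case/andP; case: sep => _ _ _ [c [cxy cxz cyz sep]].
(* A path avoiding the corner s cannot leave the color class of s. *)
have stay s v q : s \in [:: x; y; z] -> c v = c s -> s \notin v :: q ->
    path (adj E) v q -> c (last v q) = c s.
  elim: q v => //= w q IHq v sin cv; rewrite !inE !negb_or => /and3P[sv sw sq].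
  case/andP=> vw; apply: IHq => //; last by rewrite inE negb_or sw.
  rewrite -cv; apply/esym/sep => //; apply/negP=> /mem_triangle_edges vxyz.
  have vin : v \in [:: x; y; z].
    by case: vxyz => [|[|[|[|[|]]]]] [-> _]; rewrite !inE eqxx ?orbT.
  move: sv cxy cxz cyz; move: sin vin cv; rewrite !inE.
  by do 2![case/or3P=> /eqP->]; rewrite ?eqxx // => ->; rewrite eqxx.
rewrite [X in X -> _]/= => /and3P[xy yz' pz'] uxyzp.
have [Ez|nz] := eqVneq z' z; last first.
  have: c (last z' (rcons p x)) = c y.
    apply: stay => //; rewrite ?inE ?eqxx ?orbT //.
      apply/esym/sep => //; apply/negP=> /mem_triangle_edges.
      move: uxyzp; rewrite /= !inE !negb_or -!andbA.
      case/and5P=> /eqP ? /eqP ? _ /eqP ? _; move/eqP: nz => ?; intuition congruence.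
    move: uxyzp; rewrite -(rot_uniq 1) rot1_cons /= => /andP[].
    by rewrite !inE.
  by rewrite last_rcons => E1; rewrite E1 eqxx in cxy.
subst z'; case: p pz' uxyzp => [|w p] pz uxyzp; first exact: cycle_edges_triangle.
have: c (last w (rcons p x)) = c z.
  move: pz => /= /andP[zw pw].
  apply: stay => //; rewrite ?inE ?eqxx ?orbT //.
    apply/esym/sep => //; apply/negP=> /mem_triangle_edges.
    move: uxyzp; rewrite /= !inE !negb_or -!andbA.
    case/and5P=> /eqP ? /eqP ? /eqP ? _ /and5P[/eqP ? /eqP ? _ /eqP ? _].
    intuition congruence.
  move: uxyzp; rewrite -(rot_uniq 2) /rot /= => /andP[].
  by rewrite !inE mem_cat mem_rcons !inE !negb_or => /and4P[-> -> -> _].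
by rewrite last_rcons => E1; rewrite E1 eqxx in cxz.
Qed.

Lemma locally_cactus_triangular E :
  connected_graph E -> locally_cactus E -> triangular_cactus E.
Proof.
move=> conE lcE; split=> // e /lcE[x [y [z [-> sep]]]].
  by have := separated_uniq sep; rewrite /= !inE negb_or cards2 -!andbA => /andP[->].
have uxyz := separated_uniq sep.
split; last first.
  by move=> F FE /(separated_cycle sep FE)->; apply: card_triangle_edges.
exists (triangle_edges x y z); split.
  case: sep => xy xz yz _; split; first exact: graph_cycle_triangle.
  by rewrite !inE eqxx.
by move=> F [FE xyF]; rewrite (separated_cycle sep FE xyF).
Qed.

(** A path from [x] to [y] off the triangle, closed by the edge [xy], is a cycle through [xy]. By
    uniqueness it is the triangle itself, yet it cannot use the deleted edge [xz]. *)
Lemma triangular_cactus_disconnect E x y z : triangular_cactus E -> uniq [:: x; y; z] ->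
    [set x; y] \in E -> [set x; z] \in E -> [set y; z] \in E ->
  ~~ connect (adj (E :\: triangle_edges x y z)) x y.
Proof.
case=> _ _ cE u xy xz yz; set E' := _ :\: _.
have nxy : x != y by move: u; rewrite /= !inE negb_or -!andbA => /andP[].
apply/negP=> /connectP[p0 /shortenP[p]]; case/lastP: p => [|p y'] /= px up _ Ey.
  by rewrite Ey eqxx in nxy.
rewrite last_rcons in Ey; subst y'.
have uyxp : uniq [:: y, x & p].
  by rewrite -(rot_uniq 1) rot1_cons /= rcons_uniq; move: up; rewrite /= rcons_uniq.
have p0n : 0 < size p.
  by case: p px {up uyxp} => //=; rewrite /adj !inE eqxx.
have [[F [_ uniF]] _] := cE _ xy.
have: F = cycle_edges [:: y, x & p].
  apply: uniF; split; last first.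
    apply/imsetP; exists y; first exact: mem_head.
    by rewrite /= eqxx setUC.
  exists [:: y, x & p]; split=> //; rewrite /ucycle uyxp andbT /= {1}/adj setUC xy /=.
  by apply: sub_path px => v w; rewrite /adj inE => /andP[].
have ->: F = triangle_edges x y z.
  by apply: uniF; split; [apply: graph_cycle_triangle|rewrite !inE eqxx].
move/setP/(_ [set x; z]); rewrite !inE eqxx orbT /= => /esym/imsetP[v vc].
(* Steps of the closed path: edges of [E'], and the closing step from [y] to [x]. Neither can be the
   edge [xz]. *)
pose r v w := adj E' v w || ((v == y) && (w == x)).
have: r v (next [:: y, x & p] v).
  apply: next_cycle vc; rewrite /= {1}/r !eqxx orbT /=.
  by apply: sub_path px => ? ? h; rewrite /r h.
case/orP=> [|/andP[/eqP-> /eqP->]]; last first.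
  case/set2_eq=> -[Ex Ez]; first by rewrite Ex eqxx in nxy.
  by move: u; rewrite Ez /= !inE eqxx andbF.
by rewrite /adj => vE E1; move: vE; rewrite -E1 !inE eqxx ?orbT.
Qed.

Lemma triangular_locally_cactus E : triangular_cactus E -> locally_cactus E.
Proof.
move=> cactE e eE; case: (cactE) => _ _ /(_ e eE)[[F [[FE eF] uniF]] cardF].
have := cardF F FE eF.
case: (FE) => c [szc ucc EF]; rewrite EF in eF *.
have [x [y [z [p [-> -> ucp]]]]] := cycle_edges_cons szc ucc eF.
case: p ucp => [|w p] /andP[cp up] cardc; last first.
  (* A cycle of length at least four has at least four edges. The predecessor [u] of [x] may
     coincide with [w]; the four edges listed below are distinct even then. *)
  move: cardc; set c' := [:: x, y, z, w & p] => cardc.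
  pose u := prev c' x; have uc : u \in c' by rewrite mem_prev mem_head.
  have nu : next c' u = x by rewrite next_prev.
  move: (up); rewrite /= !inE !negb_or -!andbA.
  case/and5P=> /eqP xy /eqP xz /eqP xw _ /and5P[/eqP yz /eqP yw _ /eqP zw _].
  have nx : next c' x = y by rewrite /= eqxx.
  have ny : next c' y = z by rewrite /= eqxx (introF eqP (nesym xy)).
  have nz : next c' z = w by rewrite /= eqxx (introF eqP (nesym xz)) (introF eqP (nesym yz)).
  clearbody u; have [xu [yu zu]] : x <> u /\ y <> u /\ z <> u.
    by split; [|split] => Eu; subst u; congruence.
  pose es := [:: [set x; y]; [set y; z]; [set z; w]; [set u; x]].
  have: 4 <= #|cycle_edges c'|.
    rewrite -[4]/(size es) cardE; apply: uniq_leq_size; last first.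
      move=> e'; rewrite mem_enum !inE => /or4P[]/eqP->; apply/imsetP.
      - by exists x; rewrite ?nx // mem_head.
      - by exists y; rewrite ?ny // !inE eqxx orbT.
      - by exists z; rewrite ?nz // !inE eqxx !orbT.
      - by exists u; rewrite ?nu.
    rewrite /= !inE !negb_or -!andbA !andbT.
    by apply/and5P; split; last (apply/andP; split);
      apply/eqP=> /set2_eq[][] *; congruence.
  by rewrite cardc.
have [xy [yz xz]] : [set x; y] \in E /\ [set y; z] \in E /\ [set x; z] \in E.
  by move: cp; rewrite /= andbT /adj (setUC [set z]) => /and3P[].
exists x, y, z; split=> //; split=> //.
set E' := E :\: triangle_edges x y z.
have csym : connect_sym (adj E') by apply: sym_connect_sym; apply: adj_sym.
(* The colour of a vertex is the representative of its component without the edges of the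
   triangle. *)
exists (fingraph.root (adj E')).
have [u1 u2] : uniq [:: x; z; y] /\ uniq [:: y; z; x].
  move: up; rewrite /= !inE !negb_or !andbT ![z == _]eq_sym ![y == x]eq_sym.
  by case/andP=> /andP[-> ->] ->.
split; try (rewrite root_connect //).
- exact: triangular_cactus_disconnect.
- by rewrite /E' triangle_edgesC; apply: triangular_cactus_disconnect; rewrite 1?(setUC [set z]).
- rewrite /E' triangle_edges_rot triangle_edges_rot.
  by apply: triangular_cactus_disconnect; rewrite // setUC.
- move=> v w vw ntri; apply/eqP; rewrite root_connect //; apply: connect1.
  by rewrite /adj inE ntri.
Qed.

End Cycles.

(** * Counting marked cacti up to relabeling *)

Section Orbits.
Variables (aT : finGroupType) (Y : finType) (to : {action aT &-> Y}) (G : {group aT}).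
Implicit Types X : {set Y}.

Definition stable X := forall x s, x \in X -> to x s \in X.

Lemma card_orbits_setU X1 X2 : stable X2 -> [disjoint X1 & X2] ->
  #|orbit to G @: (X1 :|: X2)| = #|orbit to G @: X1| + #|orbit to G @: X2|.
Proof.
move=> st2 dis; rewrite imsetU cardsU [_ :&: _](_ : _ = set0) ?cards0 ?subn0 //.
apply/setP=> w; rewrite !inE; apply/negP=> /andP[/imsetP[x x1 ->] /imsetP[y y2] /eqP].
rewrite orbit_eq_mem => /orbitP[s _ Ex]; move: (st2 y s y2); rewrite Ex => x2.
by have := disjointFr dis x1; rewrite x2.
Qed.

Lemma card_orbits_imset X (g : Y -> Y) : stable X ->
    {in X, forall x s, g (to x s) = to (g x) s} -> {in X &, injective g} ->
  #|orbit to G @: (g @: X)| = #|orbit to G @: X|.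
Proof.
move=> stX eqv injg.
have oE x : x \in X -> orbit to G (g x) = g @: orbit to G x.
  move=> xX; apply/setP=> y; apply/orbitP/imsetP=> [[s sG <-]|[_ /orbitP[s sG <-] ->]].
    by exists (to x s); rewrite ?eqv ?mem_orbit.
  by exists s; rewrite ?eqv.
rewrite -imset_comp (eq_in_imset (g := (fun w : {set Y} => g @: w) \o orbit to G)) //.
rewrite imset_comp card_in_imset // => _ _ /imsetP[x xX ->] /imsetP[y yX ->] E.
have: g x \in g @: orbit to G y by rewrite -E imset_f ?orbit_refl.
case/imsetP=> _ /orbitP[s sG <-] /injg Ex; apply/eqP; rewrite orbit_eq_mem.
by rewrite Ex ?stX ?mem_orbit.
Qed.

(** The type [T] may be infinite, so the list of objects is built along the finite list of orbits,
    one object for each. *)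
Lemma has_card_orbits (T : eqType) (P : T -> Prop) X (R : Y -> T -> Prop) :
    (forall x, x \in X -> exists2 o, P o & R x o) ->
    (forall o, P o -> exists2 x, x \in X & R x o) ->
    (forall x o o', x \in X -> R x o -> R x o' -> o = o') ->
    (forall x x' o, x \in X -> x' \in X -> R x o ->
       R x' o <-> x' \in orbit to G x) ->
  has_card P #|orbit to G @: X|.
Proof.
move=> totX totP funR orbR; rewrite cardE.
suff [s [us <- sP]] : exists s, [/\ uniq s, size s = size (enum (orbit to G @: X))
    & forall o, o \in s <-> exists2 x, x \in X /\ orbit to G x \in enum (orbit to G @: X)
                                    & P o /\ R x o].
  exists s; split=> // o; rewrite sP; split=> [[x _ []//]|Po].
  have [x xX xo] := totP o Po; exists x => //; split=> //.
  by rewrite mem_enum imset_f.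
have: {subset enum (orbit to G @: X) <= orbit to G @: X} by move=> w; rewrite mem_enum.
elim: (enum _) (enum_uniq (orbit to G @: X)) => [|w l IHl] /=.
  by exists [::]; split=> // o; split=> // -[x []].
case/andP=> wl /IHl{}IHl sub; have [|s [us szs sP]] := IHl.
  by move=> w' w'l; apply: sub; rewrite inE w'l orbT.
have /imsetP[x xX Ew] := sub w (mem_head _ _); have [o Po xo] := totX x xX.
exists (o :: s); split=> /=; rewrite ?szs //.
  rewrite us andbT; apply/negP=> /sP[x' [x'X x'l] [_ /(orbR _ _ _ xX x'X xo)]].
  by rewrite -orbit_eq_mem => /eqP Ex'; rewrite Ew -Ex' x'l in wl.
move=> o'; rewrite inE; split=> [/orP[/eqP->|/sP[x' [x'X x'l] xo']]|].
- by exists x; rewrite // inE Ew eqxx.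
- by exists x'; rewrite // inE x'l orbT.
case=> x' [x'X]; rewrite inE => /orP[/eqP Ex'|x'l] [Po' xo']; apply/orP; last first.
  by right; apply/sP; exists x'.
left; apply/eqP; apply: (funR x') => //; apply/(orbR x) => //.
by rewrite -orbit_eq_mem Ex' Ew.
Qed.

End Orbits.

Section Structures.
Variable V : finType.
Local Notation structure := ({set {set V}} * {set V})%type.
Implicit Types (t a b : tree V) (s : {perm V}) (x : structure) (k : kind).

Definition relabel x s : structure := (relabel_graph s x.1, s @: x.2).

Lemma relabel_is_action : is_action [set: {perm V}] relabel.
Proof.
have imK s (A B : {set V}) : s @: A = s @: B -> A = B.
  by apply: imset_inj; apply: perm_inj.
apply: is_total_action => [[E A]|[E A] s1 s2]; rewrite /relabel /relabel_graph /=.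
  congr (_, _); last by rewrite (eq_imset (g := id)) ?imset_id // => v; rewrite perm1.
  rewrite (eq_imset (g := id)) ?imset_id // => e.
  by rewrite (eq_imset (g := id)) ?imset_id // => v; rewrite perm1.
congr (_, _); last by rewrite -imset_comp; apply: eq_imset => v; rewrite permM.
rewrite -imset_comp; apply: eq_imset => e /=; rewrite -imset_comp.
by apply: eq_imset => v; rewrite permM.
Qed.
Canonical relabel_action := Action relabel_is_action.

Definition full t := perm_eq (lab t) (enum V).

Definition struct k t : structure := (gr t, mark k t).

Definition structs k (p : pred (tree V)) : {set structure} :=
  [set x | `[< exists t, [/\ full t, p t & x = struct k t] >]].

Lemma structsP k (p : pred (tree V)) x :
  reflect (exists t, [/\ full t, p t & x = struct k t]) (x \in structs k p).
Proof. by rewrite inE; apply: asboolP. Qed.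

Lemma full_uniq t : full t -> uniq (lab t).
Proof. by move/perm_uniq->; apply: enum_uniq. Qed.

Lemma full_mem t v : full t -> v \in lab t.
Proof. by move/perm_mem->; rewrite mem_enum. Qed.

Lemma full_size t : full t -> size (lab t) = #|V|.
Proof. by move/perm_size->; rewrite cardE. Qed.

Lemma uniq_full t : uniq (lab t) -> (forall v, v \in lab t) -> full t.
Proof. by move=> u m; apply: uniq_perm; rewrite ?enum_uniq // => v; rewrite m mem_enum. Qed.

Lemma full_tmap t s : full t -> full (tmap s t).
Proof.
move=> ft; apply: uniq_full => [|v]; rewrite lab_tmap.
  by rewrite map_inj_uniq ?full_uniq //; apply: perm_inj.
by rewrite -[v](permKV s) mem_map ?full_mem //; apply: perm_inj.
Qed.

Lemma relabel_edge s u v : s @: [set u; v] = [set s u; s v].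
Proof. by rewrite imsetU !imset_set1. Qed.

Lemma struct_tmap k t s : struct k (tmap s t) = relabel (struct k t) s.
Proof.
rewrite /struct /relabel /=; congr (_, _).
  elim: t => [v|t IHt a IHa b IHb] /=; first by rewrite /relabel_graph imset0.
  rewrite !gr_Add IHt IHa IHb !root_tmap /relabel_graph /triangle_edges !imsetU.
  by rewrite !imset_set1 ?relabel_edge.
case: k t => -[v|t a b]; rewrite /= ?imset0 ?imset_set1 ?root_tmap //.
- by rewrite relabel_edge.
- by rewrite imsetU relabel_edge imset_set1.
Qed.

Lemma struct_keq k t t' : full t -> full t' ->
  valid Triangle t -> valid Triangle t' -> struct k t = struct k t' -> keq k t t'.
Proof. by move=> ft ft' vt vt' [E M]; apply: gr_mark_det => //; apply: full_uniq. Qed.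

Lemma keq_struct k t t' : keq k t t' -> struct k t = struct k t'.
Proof. by move=> tt'; rewrite /struct (keq_gr tt') (keq_mark tt'). Qed.

Lemma keq_full k t t' : keq k t t' -> full t = full t'.
Proof. by move=> /keq_lab tt'; rewrite /full (permPl tt'). Qed.

Lemma structs_stable k (p : pred (tree V)) :
  (forall s t, p (tmap s t) = p t) -> stable relabel_action (structs k p).
Proof.
move=> pm x s /structsP[t [ft pt ->]]; apply/structsP.
by exists (tmap s t); split; rewrite ?pm ?struct_tmap //; apply: full_tmap.
Qed.

(** Both trees have the same shape and use each vertex once; the permutation sends the vertex at
    each position of [t] to the one at the same position of [t']. *)
Lemma tmap_full_perm (L : eqType) (f : V -> L) t t' : full t -> full t' ->
  tmap f t = tmap f t' -> exists2 s : {perm V}, f \o s =1 f & tmap s t = t'.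
Proof.
move=> ft ft' E; pose g v := nth v (lab t') (index v (lab t)).
have szE : size (lab t) = size (lab t') by rewrite !full_size.
have idx v : index v (lab t) < size (lab t') by rewrite -szE index_mem full_mem.
have inj_g : injective g.
  move=> v w; rewrite /g (set_nth_default v w) //.
  move/eqP; rewrite nth_uniq ?full_uniq // => /eqP Ei.
  by rewrite -[v](nth_index v (full_mem v ft)) Ei nth_index ?full_mem.
have Eg : map (perm inj_g) (lab t) = lab t'.
  apply: (@eq_from_nth _ (root t)); rewrite size_map // => i lt_i.
  rewrite (nth_map (root t)) // permE /g index_uniq ?full_uniq //.
  by apply: set_nth_default; rewrite -szE.
exists (perm inj_g); last exact: tmap_positional E Eg.
have /eq_in_map Ef : map (f \o perm inj_g) (lab t) = map f (lab t).
  by rewrite map_comp Eg -!lab_tmap E.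
by move=> v; apply/Ef/full_mem.
Qed.

(* For f injective G is trivial (labeled setting); for f constant G consists of all
   permutations (unlabeled setting). *)
Section Counting.
Variables (L : eqType) (S : spec L) (f : V -> L) (G : {group {perm V}}).
Hypotheses (wf_enum : wf S (map f (enum V)))
  (memG : forall s : {perm V}, s \in G <-> f \o s =1 f).

(** A marked graph and an object are related through a tree on [V] that yields the former and whose
    [f]-image represents the latter. Two trees with the same object differ by a rewriting, lifted to
    [V] by [keq_tmap_lift], and by a permutation in [G]. *)
Lemma count_model k (T : eqType) (lT : T -> seq L) (R : tree L -> T -> Prop) :
    model S k lT R ->
  has_card (fun o : T => perm_eq (lT o) (map f (enum V)))
           #|orbit relabel_action G @: structs k (valid k)|.
Proof.
move=> M; pose Rel x o := exists t, [/\ full t, valid k t, x = struct k t & R (tmap f t) o].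
have enumE t : full t -> perm_eq (lab (tmap f t)) (map f (enum V)).
  by move=> ft; rewrite lab_tmap; apply: perm_map.
have det t t' o : full t -> full t' -> struct k t = struct k t' ->
    valid k t -> valid k t' -> R (tmap f t) o -> R (tmap f t') o.
  move=> ft ft' E vt vt'; apply: (model_keq M); apply: keq_tmap.
  by apply: struct_keq E => //; apply: valid_triangle; eassumption.
apply: (has_card_orbits (R := Rel)).
- move=> _ /structsP[t [ft vt ->]].
  have [||o to] := model_ex M (t := tmap f t); first by rewrite valid_tmap.
    by apply: wf_perm wf_enum; rewrite perm_sym enumE.
  exists o; last by exists t.
  by rewrite -(permPl (model_lab M to)) enumE.
(* The labels of a tree [u] for [o] are the [f]-labels of the vertices, read at the positions [Is];
   the vertices at these positions fill the shape of [u]. The default [v0] for [nth] exists because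
   a tree has at least one label. *)
- move=> o lo; have [u uo] := model_tot M o.
  have /(perm_iotaP (root u)) := perm_trans (model_lab M uo) lo.
  move=> [Is pI Eu].
  have sz := size_map f (enum V); rewrite sz in pI.
  case: (pickP V) => [v0 _|V0]; last first.
    have := perm_size (perm_trans (model_lab M uo) lo).
    by rewrite size_map -cardE (eq_card0 V0) => /eqP; rewrite eqn0Ngt size_lab_gt0.
  have [t lt tu] : exists2 t, lab t = map (nth v0 (enum V)) Is & tmap f t = u.
    apply: tmap_fill; rewrite Eu -map_comp; apply/eq_in_map=> i.
    by rewrite (perm_mem pI) mem_iota /= add0n => lt_i; rewrite /= (nth_map v0).
  have ft : full t.
    by rewrite /full lt; apply/(perm_iotaP v0); exists Is.
  have vt : valid k t by rewrite -(valid_tmap f) tu (model_valid M uo).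
  exists (struct k t); first by apply/structsP; exists t.
  by exists t; rewrite tu.
- move=> _ o o' /structsP[t [ft vt ->]] [t1 [ft1 vt1 E1 to]] [t2 [ft2 vt2 E2 to']].
  by apply: (model_fun M to); apply: det to'; rewrite -?E1.
- move=> x x' o /structsP[t0 [ft0 vt0 Et0]] /structsP[t0' [ft0' vt0' Et0']].
  move=> [t [ft vt -> to]]; split.
    move=> [t' [ft' vt' -> t'o]]; have := model_det M to t'o.
    case/keq_tmap_lift=> t1 tt1 E1.
    have ft1 : full t1 by rewrite -(keq_full tt1).
    have [s sf Es] := tmap_full_perm ft1 ft' E1.
    apply/orbitP; exists s; first exact/memG.
    by rewrite /= -Es struct_tmap (keq_struct tt1).
  case/orbitP=> s /memG sf <-; exists (tmap s t); rewrite valid_tmap; split=> //.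
  - exact: full_tmap.
  - by rewrite struct_tmap.
  - by rewrite tmap_comp (eq_tmap _ sf).
Qed.

End Counting.
End Structures.

(** * Dissymmetry *)

Section Dissymmetry.
Variable V : finType.
Local Notation structure := ({set {set V}} * {set V})%type.
Implicit Types (t a b : tree V) (s : {perm V}) (x : structure) (k : kind).
Implicit Types (E : {set {set V}}).

Lemma gr_connect t v w : full t -> connect (adj (gr t)) v w.
Proof.
move=> ft; have rootc u : connect (adj (gr t)) (root t) u.
  apply: (gr_ind (P := connect _ _) (connect0 _ _)) (full_mem u ft) => x y _ cx xy.
  exact: connect_trans cx (connect1 xy).
apply: connect_trans (rootc w); rewrite sym_connect_sym //; exact: adj_sym.
Qed.

Lemma locally_cactus_full E r : (forall w, connect (adj E) r w) -> locally_cactus E ->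
  exists t, [/\ full t, gr t = E & root t = r].
Proof.
move=> con lc; have [||w|//|t [u m g rt]] := @locally_cactus_tree _ [set: V] E r.
- exact: in_setT.
- by move=> e _; apply: subsetT.
- by rewrite con.
by exists t; split=> //; apply: uniq_full => // v; rewrite m inE.
Qed.

(** The tree is not transformed: its graph is locally a cactus, from which a tree with root [v] is
    built afresh. *)
Lemma reroot t v : full t -> exists t', [/\ full t', gr t' = gr t & root t' = v].
Proof.
move=> ft; apply: locally_cactus_full => [w|]; first exact: gr_connect.
exact/gr_locally_cactus/full_uniq.
Qed.

(** Rerooting at the third corner [z] of the triangle on [e] makes [e] the opposite edge. Incidences
    are thus as many as edges. *)
Lemma gr_flag t e : full t -> e \in gr t ->
  exists t', [/\ full t', valid Triangle t', gr t' = gr t & mark Flag t' = e].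
Proof.
move=> ft et; have [x [y [z [-> sep]]]] := gr_locally_cactus (full_uniq ft) et.
case: (sep) => xy xz yz _.
have [t1 [ft1 g1 r1]] := reroot z ft.
have [t2 [a [b [k2 ra]]]] : exists t2 a b, keq Vertex t1 (Add t2 a b) /\ root a = x.
  by apply: gr_extract; rewrite ?full_uniq // g1 r1 setUC.
have ft2 : full (Add t2 a b) by rewrite -(keq_full k2).
have g2 : gr (Add t2 a b) = gr t by rewrite -(keq_gr k2).
exists (Add t2 a b); split=> //=; rewrite ra; congr [set _; _].
have rt2 : root t2 = z by rewrite -r1 (keq_root k2).
by apply/esym/(triangle_third (full_uniq ft2)); rewrite g2 ?rt2 ?ra // setUC.
Qed.

Lemma gr_eq0 t : valid Triangle t = (gr t != set0).
Proof.
case: t => [v|t a b]; first by rewrite eqxx.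
by apply/esym/set0Pn; exists [set root t; root a]; rewrite in_gr_Add !inE eqxx.
Qed.

(** With T triangles there are 3T edges and 2T + 1 vertices; T is eliminated. *)
Lemma card_gr t : uniq (lab t) -> 2 * #|gr t| + 3 = 3 * size (lab t).
Proof.
elim: t => [v|t IHt a IHa b IHb] u; first by rewrite cards0.
have [ut ua ub d] := uniq_Add u; have [ta tb ab] := root_neq u.
have cardU (A B : {set {set V}}) : (forall e, e \in A -> e \in B -> False) ->
    #|A :|: B| = #|A| + #|B|.
  move=> dAB; rewrite cardsU [_ :&: _](_ : _ = set0) ?cards0 ?subn0 //.
  by apply/setP=> e; rewrite !inE; apply/negP=> /andP[/dAB].
have disj t1 t2 e : uniq (lab t1) -> (forall v, v \in lab t1 -> v \in lab t2 -> False) ->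
    e \in gr t1 -> e \in gr t2 -> False.
  move=> u1 d12 e1 e2; have [v [w [_ Ee]]] := gr_pair u1 e1.
  by apply: (d12 v); [apply: gr_sub e1 _|apply: gr_sub e2 _]; rewrite Ee set21.
have dta v : v \in lab t -> v \in lab a -> False by have [h _ _] := d v => /h/negP.
have dtb v : v \in lab t -> v \in lab b -> False by have [_ h _] := d v => /h/negP.
have dab v : v \in lab a -> v \in lab b -> False by have [_ _ h] := d v => /h/negP.
have triN e : e \in triangle_edges (root t) (root a) (root b) ->
    [/\ e \in gr t -> False, e \in gr a -> False & e \in gr b -> False].
  have [[rt ra] rb] := (mem_root t, mem_root a, mem_root b).
  by rewrite !inE -orbA => /or3P[]/eqP->; split=> e2;
    have [] := (gr_sub e2 (set21 _ _), gr_sub e2 (set22 _ _)); eauto.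
rewrite gr_Add cardU; last first.
  by move=> e /setUP[/setUP[/triN[]//|et]|ea] eb; [apply: disj et eb|apply: disj ea eb].
rewrite cardU; last by move=> e /setUP[/triN[]//|et ea]; exact: disj et ea.
rewrite cardU; last by move=> e /triN[].
have -> : #|triangle_edges (root t) (root a) (root b)| = 3.
  by apply: card_triangle_edges; rewrite /= !inE negb_or ta tb ab.
have := (IHt ut, IHa ua, IHb ub) => -[[+ +] +]; rewrite /= !size_cat.
move: #|gr t| #|gr a| #|gr b| => nt na nb.
lia.
Qed.


(* Another triangle at the same vertex lies in t, on the other side of the
   triangle of a and b. *)
Lemma size_other_flag t a b t' a' b' :
    uniq (lab (Add t a b)) -> uniq (lab (Add t' a' b')) ->
    gr (Add t a b) = gr (Add t' a' b') -> root t = root t' ->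
    mark Flag (Add t a b) <> mark Flag (Add t' a' b') ->
  size (lab a') + size (lab b') < size (lab t).
Proof.
move=> u u' E rt neM; have [_ _ _ d'] := uniq_Add u'.
have sub c c' : keq Flag (Add t' a' b') (Add t' c c') -> {subset lab c <= lab t}.
  move=> k'; have uk : uniq (lab (Add t' c c')) by rewrite -(keq_uniq k').
  have Ek : gr (Add t a b) = gr (Add t' c c') by rewrite E (keq_gr k').
  have Mk : mark Flag (Add t a b) <> mark Flag (Add t' c c') by rewrite -(keq_mark k').
  have [_ _ _ d] := uniq_Add uk.
  apply: gr_ind => [|x y xc xt xy]; last first.
    have: [set x; y] \in gr (Add t a b) by rewrite Ek in_gr_Add xy !orbT.
    case/(gr_Add_adj u xt) => [/gr_sub/(_ (set22 _ _)) //|[Ex _]].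
    by have [/(_ _)/negP + _ _] := d x; rewrite Ex rt mem_root => /(_ isT); rewrite -rt -Ex.
  have tc : [set root t; root c] \in gr (Add t a b).
    by rewrite Ek rt in_gr_Add !inE eqxx.
  case/(gr_Add_adj u (mem_root _)): (tc) => [/gr_sub/(_ (set22 _ _)) //|[_ Ec]].
  have third a0 b0 : keq Flag (Add t a b) (Add t a0 b0) -> root c = root a0 ->
      root c' = root b0.
    move=> k0 E0; have u0 : uniq (lab (Add t a0 b0)) by rewrite -(keq_uniq k0).
    by apply: (triangle_third u0); rewrite -(keq_gr k0) Ek -?E0 ?rt in_gr_Add !inE eqxx ?orbT.
  case: Mk => /=; case: Ec => Ec.
    by rewrite Ec (third a b) //; apply: keq_refl.
  by rewrite setUC Ec (third b a) //; apply: keq_swap.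
have lt : root t' \in lab t by rewrite -rt mem_root.
have := @uniq_leq_size _ (root t' :: lab a' ++ lab b') (lab t).
rewrite /= size_cat; apply.
  move: u'; rewrite /= cat_uniq => /and3P[_ /hasPn h ->]; rewrite andbT.
  by apply/negP=> /h; rewrite /= mem_root.
move=> v; rewrite inE mem_cat => /or3P[/eqP->//| |].
- by apply: sub; apply: keq_refl.
- by apply: sub; apply: keq_swap.
Qed.

(* The incidence of root t with the triangle of a and b is oriented towards root t
   if [Add t a b] is heavy, towards the triangle if it is light. *)
Definition heavy t :=
  if t is Add t a b then size (lab a) + size (lab b) < size (lab t) else false.

Definition light t :=
  if t is Add t a b then size (lab t) <= size (lab a) + size (lab b) else false.

(** Distinct light incidences at one vertex would give |a'| + |b'| < |t| <= |a| + |b| < |t'| <= |a'|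
    + |b'|, the strict inequalities coming from [size_other_flag]. A vertex is thus the source of at
    most one incidence. *)
Lemma light_flag_inj t t' : full t -> full t' -> light t -> light t' ->
  struct Vertex t = struct Vertex t' -> struct Flag t = struct Flag t'.
Proof.
case: t t' => [//|t a b] [//|t' a' b'] /full_uniq u /full_uniq u' /= l l' [E /= /set1_inj rt].
congr (_, _) => //; apply/eqP/negPn/negP=> /eqP M.
have := size_other_flag u u' E rt M.
have := size_other_flag u' u (esym E) (esym rt) (nesym M).
lia.
Qed.

Definition parts t :=
  if t is Add t a b then [:: (root t, size (lab t)); (root a, size (lab a));
    (root b, size (lab b))] else [::].

Lemma keq_parts k t t' : k <> Vertex -> keq k t t' -> perm_eq (parts t) (parts t').
Proof.
move=> nV tt'; elim: tt' nV => {k t t'} //=.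
- by move=> k t u v _ IHt _ IHu nV; apply: perm_trans (IHt nV) (IHu nV).
- move=> k t a b t' a' b' tt' _ aa' _ bb' _ _.
  rewrite (keq_root tt') (keq_root aa') (keq_root bb').
  by rewrite (perm_size (keq_lab tt')) (perm_size (keq_lab aa')) (perm_size (keq_lab bb')).
- by move=> k t a b _; rewrite perm_cons (perm_catC [:: _] [:: _]).
- by move=> t a b _; rewrite (perm_catC [:: _; _] [:: _]).
Qed.

(** The part at a heavy corner outweighs the two others together, so it is the strictly largest one
    and no second corner can be heavy. A triangle is thus the source of at most one incidence. *)
Lemma heavy_flag_inj t t' : full t -> full t' -> heavy t -> heavy t' ->
  struct Triangle t = struct Triangle t' -> struct Flag t = struct Flag t'.
Proof.
case: t t' => [//|t a b] [//|t' a' b'] ft ft' /= h h' E.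
have /= pp : perm_eq (parts (Add t a b)) (parts (Add t' a' b')).
  by apply: (@keq_parts Triangle) => //; apply: struct_keq E.
have Et := congr1 fst E.
have lt : forall p, p \in [:: (root t, size (lab t)); (root a, size (lab a));
    (root b, size (lab b))] -> p.2 <= size (lab t).
  by move=> p; rewrite !inE => /or3P[]/eqP-> /=; lia.
have lt' : forall p, p \in [:: (root t', size (lab t')); (root a', size (lab a'));
    (root b', size (lab b'))] -> p = (root t', size (lab t')) \/ p.2 < size (lab t').
  move=> p; rewrite !inE => /or3P[]/eqP-> /=; [by left|right|right]; lia.
have: (root t, size (lab t)) = (root t', size (lab t')).
  have := mem_head (root t, size (lab t)) [:: (root a, size (lab a)); (root b, size (lab b))].
  rewrite (perm_mem pp) => /lt'[//|/=].
  have := mem_head (root t', size (lab t')) [:: (root a', size (lab a')); (root b', size (lab b'))].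
  by rewrite -(perm_mem pp) => /lt /=; lia.
move=> Ett; rewrite Ett perm_cons in pp.
congr (_, _) => //=; apply/setP=> v; rewrite !inE.
have /perm_mem/(_ v) := perm_map (fst : _ -> V) pp.
by rewrite /= !inE.
Qed.

(** Recovers the vertex of an incidence from the opposite edge that marks it, as the common
    neighbour of its ends, so that the two endpoints of an incidence depend on the structure and not
    on a tree. *)
Definition apex x : {set V} :=
  [set v | (v \notin x.2) && [forall u in x.2, [set u; v] \in x.1]].

Lemma apex_struct t : full t -> valid Triangle t -> apex (struct Flag t) = [set root t].
Proof.
case: t => [//|t a b] /full_uniq u _; have [ta tb ab] := root_neq u.
apply/setP=> v; rewrite !inE; apply/andP/eqP=> [[nv /'forall_implyP E]|->].
  have k := keq_rotr t a b; rewrite -[root _]/(root t).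
  apply: (@triangle_third _ a b t); first by rewrite -(keq_uniq k).
    by rewrite -(keq_gr k); apply: E; rewrite set21.
  by rewrite -(keq_gr k); apply: E; rewrite set22.
rewrite negb_or ta tb; split=> //; apply/'forall_implyP=> w /set2P[]->;
  by rewrite setUC in_gr_Add !inE eqxx ?orbT.
Qed.

Definition flag_triangle x : structure := (x.1, apex x :|: x.2).
Definition flag_vertex x : structure := (x.1, apex x).
Definition unmark x : structure := (x.1, set0).

Lemma flag_triangleE t : full t -> valid Triangle t ->
  flag_triangle (struct Flag t) = struct Triangle t.
Proof.
move=> ft vt; rewrite /flag_triangle apex_struct //.
by case: t vt {ft} => // t a b _; rewrite /struct /= setUA.
Qed.

Lemma flag_vertexE t : full t -> valid Triangle t ->
  flag_vertex (struct Flag t) = struct Vertex t.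
Proof. by move=> ft vt; rewrite /flag_vertex apex_struct. Qed.

Definition fiber E (X : {set structure}) := [set x in X | x.1 == E].

Section Transfer.
Variables (k k' : kind) (p : pred (tree V)) (g : structure -> structure).
Hypotheses (gE : forall t, full t -> p t -> g (struct k t) = struct k' t)
  (g_inj : forall t t', full t -> full t' -> p t -> p t' ->
     struct k' t = struct k' t' -> struct k t = struct k t').

Lemma structs_imset : g @: structs k p = structs k' p.
Proof.
apply/setP=> x; apply/imsetP/structsP=> [[_ /structsP[t [ft pt ->]] ->]|[t [ft pt ->]]].
  by exists t; rewrite gE.
by exists (struct k t); rewrite ?gE //; apply/structsP; exists t.
Qed.

Lemma structs_injective : {in structs k p &, injective g}.
Proof.
move=> _ _ /structsP[t [ft pt ->]] /structsP[t' [ft' pt' ->]].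
by rewrite !gE //; apply: g_inj.
Qed.

Lemma card_orbits_structs (G : {group {perm V}}) :
    (forall s t, p (tmap s t) = p t) ->
  #|orbit (relabel_action V) G @: structs k p| = #|orbit (relabel_action V) G @: structs k' p|.
Proof.
move=> ps; rewrite -structs_imset card_orbits_imset //.
- exact: structs_stable.
- move=> _ /structsP[t [ft pt ->]] s.
  have rE q u : relabel_action V (struct q u) s = struct q (tmap s u).
    by rewrite struct_tmap.
  by rewrite rE !gE ?rE //; [apply: full_tmap|rewrite ps].
- exact: structs_injective.
Qed.

Lemma card_fiber_structs E :
  #|fiber E (structs k p)| = #|fiber E (structs k' p)|.
Proof.
rewrite /fiber -structs_imset -(card_in_imset (f := g)); last first.
  by move=> x y /setIdP[xs _] /setIdP[ys _]; apply: structs_injective.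
have g1 x : x \in structs k p -> (g x).1 = x.1.
  by move=> /structsP[t [ft pt ->]]; rewrite gE.
apply: eq_card => y; apply/imsetP/setIdP=> [[x /setIdP[xs xE] ->]|].
  by rewrite imset_f // g1.
case=> /imsetP[x xs ->]; rewrite g1 // => xE.
by exists x; rewrite // inE xs.
Qed.

End Transfer.

End Dissymmetry.

Arguments heavy {V} t.
Arguments light {V} t.

(** * Sinks of the orientation in a fixed graph *)

Section Sinks.
Variable V : finType.
Local Notation structure := ({set {set V}} * {set V})%type.
Implicit Types (t a b : tree V) (s : {perm V}) (x : structure) (k : kind).
Implicit Types (E : {set {set V}}) (X : {set structure}).

Lemma heavy_tmap s t : heavy (tmap s t) = heavy t.
Proof. by case: t => //= t a b; rewrite !lab_tmap !size_map. Qed.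

Lemma light_tmap s t : light (tmap s t) = light t.
Proof. by case: t => //= t a b; rewrite !lab_tmap !size_map. Qed.

(** The part at the root is larger than the two others, hence is not a single vertex: incidences
    oriented towards a vertex are always at cut vertices. *)
Lemma heavy_valid t : heavy t -> valid Vertex t.
Proof. by case: t => [//|[v|//] a b] /=; have := size_lab_gt0 a; lia. Qed.

Lemma heavyN t : valid Triangle t -> heavy t = ~~ light t.
Proof. by case: t => //= t a b _; rewrite ltnNge. Qed.

Lemma keq_heavy t t' : keq Flag t t' -> heavy t = heavy t'.
Proof.
move Ek: Flag => k tt'; elim: tt' Ek => {k t t'} //=.
- by move=> k t u v _ IHt _ IHu Ek; rewrite IHt // IHu.
- move=> k t a b t' a' b' tt' _ aa' _ bb' _ _.
  by rewrite (perm_size (keq_lab tt')) (perm_size (keq_lab aa')) (perm_size (keq_lab bb')).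
- by move=> k t a b _; rewrite addnC.
Qed.

Lemma validVT t : valid Vertex t -> valid Triangle t.
Proof. by case: t => // -[]. Qed.

Lemma valid_flag t : valid Flag t = valid Vertex t.
Proof. by case: t. Qed.

Lemma sub_structs k (p q : pred (tree V)) :
  subpred p q -> structs k p \subset structs k q.
Proof.
move=> pq; apply/subsetP=> x /structsP[t [ft pt ->]].
by apply/structsP; exists t; rewrite pq.
Qed.

Lemma structs_split k (p q r : pred (tree V)) : (forall t, p t = q t || r t) ->
  structs k p = structs k q :|: structs k r.
Proof.
move=> pqr; apply/setP=> x; rewrite in_setU; apply/structsP/orP=> [[t [ft + ->]]|].
  by rewrite pqr => /orP[qt|rt]; [left|right]; apply/structsP; exists t.
by case=> /structsP[t [ft pt ->]]; exists t; rewrite pqr pt ?orbT.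
Qed.

Lemma fiberU E X1 X2 : fiber E (X1 :|: X2) = fiber E X1 :|: fiber E X2.
Proof. by apply/setP=> x; rewrite /fiber !inE andb_orl. Qed.

Lemma card_fiberD E X1 X2 : X2 \subset X1 ->
  #|fiber E (X1 :\: X2)| = #|fiber E X1| - #|fiber E X2|.
Proof.
move=> s21; rewrite -cardsDS; last first.
  by apply/subsetP=> x /setIdP[x2 xE]; apply/setIdP; split=> //; apply: (subsetP s21).
apply: eq_card => x; apply/setIdP/setDP=> [[/setDP[x1 x2] xE]|[/setIdP[x1 xE] x2]].
  by split; [apply/setIdP|apply: contra x2 => /setIdP[]].
by split=> //; apply/setDP; split=> //; apply: contra x2 => x2; apply/setIdP.
Qed.

Lemma card_fiberU E X1 X2 : [disjoint X1 & X2] ->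
  #|fiber E (X1 :|: X2)| = #|fiber E X1| + #|fiber E X2|.
Proof.
move=> d12; rewrite fiberU cardsU [_ :&: _](_ : _ = set0) ?cards0 ?subn0 //.
apply/setP=> x; rewrite in_set0; apply/negP=> /setIP[/setIdP[x1 _] /setIdP[x2 _]].
by rewrite (disjointFr d12 x1) in x2.
Qed.

Lemma card_fiber_vertex t : full t -> valid Triangle t ->
  #|fiber (gr t) (structs Vertex (valid Triangle))| = #|V|.
Proof.
move=> ft vt; rewrite -cardsT -(card_imset _ (f := fun v : V => (gr t, [set v]))).
  2: by move=> v w [/set1_inj].
apply: eq_card => x; apply/setIdP/imsetP=> [[/structsP[t' [ft' vt' ->]] /eqP /= <-]|].
  by exists (root t').
case=> v _ ->; split; rewrite //=; apply/structsP.
have [t' [ft' gt' rt']] := reroot v ft.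
by exists t'; rewrite gr_eq0 gt' -gr_eq0 /struct gt' /= rt'.
Qed.

Lemma card_fiber_flag t : full t -> valid Triangle t ->
  #|fiber (gr t) (structs Flag (valid Triangle))| = #|gr t|.
Proof.
move=> ft vt; rewrite -(card_imset _ (f := fun e : {set V} => (gr t, e))).
  2: by move=> v w [].
apply: eq_card => x; apply/setIdP/imsetP=> [[/structsP[t' [ft' vt' ->]] /eqP /= <-]|].
  exists (mark Flag t') => //; case: t' vt' {ft'} => // t' a b _ /=.
  by rewrite in_gr_Add !inE eqxx !orbT.
case=> e et ->; split; rewrite //=; apply/structsP.
by have [t' [ft' vt' gt' <-]] := gr_flag ft et; exists t'; rewrite /struct gt'.
Qed.

(** Double counting of incidences: those mapped to a given triangle by [flag_triangle] are marked by
    its three edges. *)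
Lemma card_fiber_triangle t : full t -> valid Triangle t ->
  3 * #|fiber (gr t) (structs Triangle (valid Triangle))| = #|gr t|.
Proof.
move=> ft vt; rewrite -(card_fiber_flag ft vt) mulnC.
set A := fiber _ (structs Flag _); set B := fiber _ _.
have AB x : x \in A -> flag_triangle x \in B.
  case/setIdP=> /structsP[t' [ft' vt' ->]] xE; rewrite flag_triangleE //.
  by apply/setIdP; split=> //; apply/structsP; exists t'.
rewrite -[#|A|]sum1_card (partition_big (@flag_triangle V) (mem B) AB) /=.
rewrite -sum_nat_const; apply: eq_bigr => y /setIdP[/structsP[t' [ft' vt' ->]] /eqP /= gt'].
rewrite sum1dep_card; case: t' ft' vt' gt' => // t' a b ft' _ gt'.
have [ta tb ab] := root_neq (full_uniq ft').
have <- : #|triangle_edges (root t') (root a) (root b)| = 3.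
  by rewrite card_triangle_edges //= !inE negb_or ta tb ab.
rewrite -(card_imset _ (f := fun e : {set V} => (gr t, e))); last by move=> ? ? [].
apply: eq_card => x; apply/imsetP/idP.
  have rotE u : keq Triangle (Add t' a b) u -> valid Triangle u ->
      (gr t, mark Flag u) \in
        [pred x | (x \in A) && (flag_triangle x == struct Triangle (Add t' a b))].
    move=> k vu; have fu : full u by rewrite -(keq_full k).
    have Eu : (gr t, mark Flag u) = struct Flag u by rewrite /struct -(keq_gr k) gt'.
    rewrite inE Eu flag_triangleE // (keq_struct k) eqxx andbT.
    apply/setIdP; split; first by apply/structsP; exists u.
    by rewrite -Eu.
  case=> e; rewrite !inE -orbA => /or3P[]/eqP-> ->.
  - by have := rotE _ (keq_rot t' a b) isT; rewrite !inE.
  - have := rotE _ (keq_rotr t' a b) isT; rewrite !inE /= [[set root b; _]]setUC; exact.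
  - by have := rotE _ (keq_refl _ _) isT; rewrite !inE.
rewrite inE => /andP[/setIdP[/structsP[u [fu vu ->]] /eqP /= gu]].
rewrite flag_triangleE // => /eqP[_ Mu]; exists (mark Flag u); last by rewrite /struct gu.
case: u fu vu {gu} Mu => // u c d /full_uniq/root_neq[_ _ cd] _ /= Mu.
have: root c \in [set root t'; root a; root b] by rewrite -Mu !inE eqxx !orbT.
have: root d \in [set root t'; root a; root b] by rewrite -Mu !inE eqxx !orbT.
rewrite !inE -!orbA => /or3P[]/eqP Ed /or3P[]/eqP Ec; rewrite Ec Ed ?eqxx // in cd *;
  by rewrite ?eqxx ?orbT // (setUC [set root _]) eqxx ?orbT.
Qed.

(* The sinks of the orientation. *)
Definition balanced_triangles : {set structure} :=
  structs Triangle (valid Triangle) :\: structs Triangle heavy.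

Definition balanced_vertices : {set structure} :=
  structs Vertex (valid Triangle) :\: structs Vertex light.

Lemma triangle_vertex_disjoint (p q : pred (tree V)) : subpred p (valid Triangle) ->
  [disjoint structs Triangle p & structs Vertex q].
Proof.
move=> pv; apply/pred0P=> x /=; apply/negP=> /andP[/structsP[t [ft pt ->]]].
case/structsP=> t' [_ _ [_ M]]; case: t ft {pt}(pv _ pt) M => // t a b /full_uniq u _ M.
have [ta _ _] := root_neq u.
have : root a \in [set root t'] by rewrite -[[set _]]M !inE eqxx !orbT.
have : root t \in [set root t'] by rewrite -[[set _]]M !inE eqxx.
by rewrite !inE => /eqP E1 /eqP E2; rewrite E1 E2 eqxx in ta.
Qed.

Lemma balanced_disjoint : [disjoint balanced_triangles & balanced_vertices].
Proof.
apply: (disjointWl (subsetDl _ _)); apply: (disjointWr (subsetDl _ _)).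
exact: triangle_vertex_disjoint.
Qed.

Lemma light_valid t : light t -> valid Triangle t.
Proof. by case: t. Qed.

Lemma flag_disjoint (p q : pred (tree V)) : subpred p heavy -> subpred q light ->
  [disjoint structs Flag p & structs Flag q].
Proof.
move=> ph ql; apply/pred0P=> x /=; apply/negP=> /andP[/structsP[t [ft /ph ht ->]]].
case/structsP=> t' [ft' /ql lt' E].
have vt := validVT (heavy_valid ht); have vt' := light_valid lt'.
have kF : keq Flag t t' by apply: struct_keq E.
by move: lt'; rewrite -[light _]negbK -heavyN // -(keq_heavy kF) ht.
Qed.

(* Every vertex or triangle that is not a sink is the source of one incidence, and
   there are #|V| + #|gr t| / 3 - #|gr t| = 1 more vertices and triangles than
   incidences. *)
Lemma card_fiber_balanced t : full t -> valid Triangle t ->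
  #|fiber (gr t) (balanced_triangles :|: balanced_vertices)| = 1.
Proof.
move=> ft vt; rewrite card_fiberU ?balanced_disjoint // !card_fiberD; first last.
- by apply: sub_structs => u /heavy_valid/validVT.
- by apply: sub_structs => u /light_valid.
have cT := card_fiber_triangle ft vt; have cV := card_fiber_vertex ft vt.
have cG := card_gr (full_uniq ft); rewrite (full_size ft) in cG.
have cF := card_fiber_flag ft vt.
have cH : #|fiber (gr t) (structs Flag heavy)| = #|fiber (gr t) (structs Triangle heavy)|.
  apply: (card_fiber_structs (g := @flag_triangle V)) => [u fu /heavy_valid/validVT|].
    exact: flag_triangleE.
  exact: heavy_flag_inj.
have cL : #|fiber (gr t) (structs Flag light)| = #|fiber (gr t) (structs Vertex light)|.
  apply: (card_fiber_structs (g := @flag_vertex V)) => [u fu /light_valid|].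
    exact: flag_vertexE.
  exact: light_flag_inj.
have EF : structs Flag (valid Triangle) = structs Flag heavy :|: structs Flag (@light V).
  apply: structs_split => u; apply/idP/orP=> [vu|[/heavy_valid/validVT|/light_valid]//].
  by rewrite heavyN //; case: (light u); [right|left].
rewrite EF card_fiberU ?flag_disjoint // cH cL in cF.
have subF k (p : pred (tree V)) : subpred p (valid Triangle) ->
    #|fiber (gr t) (structs k p)| <= #|fiber (gr t) (structs k (valid Triangle))|.
  move=> pv; apply/subset_leq_card/subsetP=> x /setIdP[xp xE]; apply/setIdP; split=> //.
  exact: (subsetP (sub_structs _ pv)) xp.
have sT := subF Triangle heavy (fun u hu => validVT (heavy_valid hu)).
have sV := subF Vertex light light_valid.
lia.
Qed.

End Sinks.

(** * Dissymmetry for the orbits of a group of permutations *)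

Section OrbitDissymmetry.
Variables (V : finType) (G : {group {perm V}}).
Local Notation structure := ({set {set V}} * {set V})%type.
Local Notation act := (relabel_action V).
Local Notation norbits X := #|orbit act G @: X|.

Lemma stable_setD (X1 X2 : {set structure}) :
  stable act X1 -> stable act X2 -> stable act (X1 :\: X2).
Proof.
move=> st1 st2 x s /setDP[x1 x2]; apply/setDP; split; first exact: st1.
by apply: contra x2 => /(st2 _ s^-1%g); rewrite actK.
Qed.

Lemma stable_setU (X1 X2 : {set structure}) :
  stable act X1 -> stable act X2 -> stable act (X1 :|: X2).
Proof. by move=> st1 st2 x s /setUP[/st1|/st2] xs; apply/setUP; [left|right]. Qed.

Lemma valid_stable k k' : stable act (structs k (valid k')).
Proof. by apply: structs_stable => s t; apply: valid_tmap. Qed.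

Lemma heavy_stable k : stable act (structs k heavy).
Proof. exact/structs_stable/heavy_tmap. Qed.

Lemma light_stable k : stable act (structs k light).
Proof. exact/structs_stable/light_tmap. Qed.

Lemma balanced_stable : stable act (balanced_triangles V) /\ stable act (balanced_vertices V).
Proof.
split; apply: stable_setD; by [exact: valid_stable|exact: heavy_stable|exact: light_stable].
Qed.

(** Graphs are kept as structures with an empty mark, so that the same action applies to them. *)
Definition unmarked : {set structure} := @unmark V @: structs Vertex (valid Triangle).

Lemma balancedP x : x \in balanced_triangles V :|: balanced_vertices V ->
  exists t, [/\ full t, valid Triangle t & x.1 = gr t].
Proof. by case/setUP=> /setDP[/structsP[t [ft vt ->]] _]; exists t. Qed.

(** Each graph has exactly one sink, so forgetting the mark is an equivariant bijection from the
    sinks onto the graphs. *)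
Lemma norbits_balanced :
  norbits unmarked = norbits (balanced_triangles V) + norbits (balanced_vertices V).
Proof.
have [stT stV] := balanced_stable.
rewrite -card_orbits_setU ?balanced_disjoint //.
set B := _ :|: _; have -> : unmarked = @unmark V @: B.
  apply/setP=> y; apply/imsetP/imsetP=> [[_ /structsP[t [ft vt ->]] ->]|[x xB ->]].
    have /eqP/cards1P[x Ex] := card_fiber_balanced ft vt.
    have /setIdP[xB /eqP xE] : x \in fiber (gr t) B by rewrite Ex set11.
    by exists x; rewrite // /unmark xE.
  have [t [ft vt xE]] := balancedP xB; exists (struct Vertex t); last by rewrite /unmark xE.
  by apply/structsP; exists t.
apply: card_orbits_imset.
- exact: stable_setU.
- by move=> [E A] _ s; rewrite /unmark /= /relabel /= imset0.
- move=> x y xB yB /(congr1 fst)/= E; have [t [ft vt xE]] := balancedP xB.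
  have /eqP/cards1P[z Ez] := card_fiber_balanced ft vt.
  have : x \in fiber (gr t) B by apply/setIdP; rewrite xE.
  have : y \in fiber (gr t) B by apply/setIdP; rewrite -E xE.
  by rewrite Ez => /set1P-> /set1P->.
Qed.

(** Cutting each set of marked graphs along the orientation turns both sides into the same sum:
    sinks, heavy incidences, and light incidences at cut vertices. *)
Theorem norbits_dissymmetry :
  norbits (structs Triangle (valid Triangle)) + norbits (structs Vertex (valid Vertex)) =
  norbits unmarked + norbits (structs Flag (valid Flag)).
Proof.
(* A light incidence may sit at a vertex of a single triangle, which neither T_S nor T_{S-K} counts.
   Heavy incidences need no such restriction, by [heavy_valid]. *)
pose q (t : tree V) := light t && valid Vertex t.
have stq k : stable act (structs k q).
  by apply: structs_stable => s t; rewrite /q light_tmap valid_tmap.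
have hv : subpred heavy (@valid V Triangle) by move=> t /heavy_valid/validVT.
have ql : subpred q light by move=> t /andP[].
have cg (A B : {set structure}) : A = B -> norbits A = norbits B by move->.
have disD (A B : {set structure}) : [disjoint A :\: B & B].
  by apply/pred0P=> x /=; rewrite in_setD; case: (x \in B); rewrite ?andbF.
have -> : norbits (structs Triangle (valid Triangle)) =
    norbits (balanced_triangles V) + norbits (structs Triangle heavy).
  rewrite -card_orbits_setU ?disD //; last exact: heavy_stable.
  apply: cg; rewrite -[LHS](setID _ (structs Triangle heavy)) setUC.
  by rewrite (setIidPr (sub_structs _ hv)).
have -> : norbits (structs Vertex (valid Vertex)) =
    norbits (balanced_vertices V) + norbits (structs Vertex q).
  rewrite -card_orbits_setU //; last exact: disjointWr (sub_structs _ ql) (disD _ _).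
  apply: cg; apply/setP=> x; apply/structsP/setUP.
    case=> t [ft vt ->]; have vt3 := validVT vt.
    have [/structsP[t' [ft' lt' E]]|nl] := boolP (struct Vertex t \in structs Vertex light).
      right; apply/structsP; exists t'; split=> //; rewrite /q lt' andTb.
      have /keq_valid <- // : keq Vertex t t'.
      by apply: struct_keq E => //; apply: light_valid.
    by left; apply/setDP; split=> //; apply/structsP; exists t.
  case=> [/setDP[/structsP[t [ft vt ->]] nl]|/structsP[t [ft /andP[_ vt] ->]]];
    exists t; split=> //.
  (* A sink vertex has no light incidence, so the one at the top of [t] is heavy and the vertex is a
     cut vertex. *)
  apply: heavy_valid; rewrite heavyN //; apply: contra nl => lt.
  by apply/structsP; exists t.
have -> : norbits (structs Flag (valid Flag)) =
    norbits (structs Flag heavy) + norbits (structs Flag q).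
  rewrite -card_orbits_setU ?flag_disjoint //; apply: cg.
  apply: structs_split => t; rewrite valid_flag /q.
  have [vt|nvt] := boolP (valid Vertex t); last first.
    by rewrite andbF orbF; apply/esym/negP=> /heavy_valid; apply/negP.
  by rewrite andbT heavyN ?validVT //; case: (light t).
have -> : norbits (structs Flag heavy) = norbits (structs Triangle heavy).
  apply: (card_orbits_structs (g := @flag_triangle V)); last exact: heavy_tmap.
    by move=> t ft /heavy_valid/validVT; apply: flag_triangleE.
  exact: heavy_flag_inj.
have -> : norbits (structs Flag q) = norbits (structs Vertex q).
  apply: (card_orbits_structs (g := @flag_vertex V)).
  - by move=> t ft /andP[/light_valid + _]; apply: flag_vertexE.
  - by move=> t t' ft ft' /ql + /ql; apply: light_flag_inj.
  - by move=> s t; rewrite /q light_tmap valid_tmap.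
by rewrite norbits_balanced addnACA.
Qed.

End OrbitDissymmetry.

(** * Cacti on ['I_n] as orbits of unmarked graphs *)

Section Cacti.
Variable n : nat.
Local Notation act := (relabel_action 'I_n).

(** The bound [3 <= n] agrees with [valid Triangle]: a lone leaf has one vertex, and a tree with a
    triangle has at least three labels. *)
Lemma labeled_cactiP (E : {set {set 'I_n}}) :
  reflect (exists t, [/\ full t, valid Triangle t & gr t = E]) (E \in labeled_cacti n).
Proof.
rewrite inE; apply: (iffP andP) => [[n3 /asboolP cE]|[t [ft vt <-]]].
  have [_ con _] := cE; have r : 'I_n by case: (n) n3 => // m _; exact: ord0.
  have [t [ft gt _]] := locally_cactus_full (con r) (triangular_locally_cactus cE).
  exists t; split=> //; case: t ft {gt} => // v /full_size; rewrite card_ord => n1.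
  by rewrite -n1 in n3.
split.
  have := full_size ft; rewrite card_ord => <-; case: t vt {ft} => // t a b _ /=.
  by rewrite !size_cat -[3]/(1 + (1 + 1)) !leq_add ?size_lab_gt0.
apply/asboolP/locally_cactus_triangular; last exact/gr_locally_cactus/full_uniq.
by move=> x y; apply: gr_connect.
Qed.

Lemma unmarkedE : unmarked 'I_n = [set (E, set0) | E in labeled_cacti n].
Proof.
apply/setP=> x; apply/imsetP/imsetP=> [[_ /structsP[t [ft vt ->]] ->]|[E + ->]].
  by exists (gr t) => //; apply/labeled_cactiP; exists t.
case/labeled_cactiP=> t [ft vt <-]; exists (struct Vertex t) => //.
by apply/structsP; exists t.
Qed.

Lemma unmark_inj : injective (fun E : {set {set 'I_n}} => (E, set0 : {set 'I_n})).
Proof. by move=> E F []. Qed.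

Lemma norbits_labeled : #|orbit act 1 @: unmarked 'I_n| = #|labeled_cacti n|.
Proof.
rewrite card_imset => [|x y E]; first by rewrite unmarkedE card_imset //; apply: unmark_inj.
by have := orbit_refl act 1%G x; rewrite E => /orbitP[s /set1P-> <-]; rewrite act1.
Qed.

Lemma norbits_unlabeled : #|orbit act setT @: unmarked 'I_n| = #|unlabeled_cacti n|.
Proof.
have cls (E : {set {set 'I_n}}) : E \in labeled_cacti n -> orbit act setT (E, set0) =
    [set (F, set0) | F in [set F in labeled_cacti n | graph_iso E F]].
  move=> Ec; apply/setP=> x; apply/orbitP/imsetP=> [[s _ <-]|[F /setIdP[_ /existsP[s /eqP->]] ->]].
    exists (relabel_graph s E); last by rewrite /= /relabel /= imset0.
    apply/setIdP; split; last by apply/existsP; exists s.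
    case/labeled_cactiP: Ec => t [ft vt <-]; apply/labeled_cactiP; exists (tmap s t).
    by rewrite full_tmap // valid_tmap; split=> //; have [] := struct_tmap Vertex t s.
  by exists s; rewrite ?inE //= /relabel /= imset0.
rewrite unmarkedE -imset_comp (eq_in_imset cls).
rewrite (imset_comp (fun C : {set {set {set 'I_n}}} => [set (F, set0 : {set 'I_n}) | F in C])
  (fun E : {set {set 'I_n}} => [set F in labeled_cacti n | graph_iso E F])).
by rewrite card_imset //; apply: imset_inj; apply: unmark_inj.
Qed.

End Cacti.

(** * Labeled classes *)

Section LabeledConstructions.
Implicit Types A B : lclass.

Definition lseq A (x : A) : seq nat := enum_fset (labels x).

Lemma lseq_uniq A (x : A) : uniq (lseq x).
Proof. exact: fset_uniq. Qed.

Lemma uniq_flatten_labels A (s : seq A) :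
  uniq s -> {in s &, forall x y, x != y -> [disjoint labels x & labels y]%fset} ->
  uniq (flatten (map (@lseq A) s)).
Proof.
elim: s => //= x s IHs /andP[xs us] dis; rewrite cat_uniq lseq_uniq IHs //=; last first.
  by move=> y z ys zs; apply: dis; rewrite inE ?ys ?zs orbT.
rewrite andbT; apply/hasPn=> i /flatten_mapP[y ys iy]; apply/negP=> ix.
have /fdisjointP/(_ i ix)/negP[] // : [disjoint labels x & labels y]%fset.
by apply: dis; rewrite ?inE ?eqxx ?ys ?orbT //; apply: contra xs => /eqP->.
Qed.

Lemma lset_seq p A (x : lset p A) :
  perm_eq (lseq x) (flatten (map (@lseq A) (enum_fset (val x)))).
Proof.
case: x => s ps; have /andP[_ /forallP dis] := ps.
apply: uniq_perm; first exact: fset_uniq.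
  apply: uniq_flatten_labels => // y z ys zs yz.
  have /forallP/(_ [` zs]%fset)/implyP := dis [` ys]%fset; apply.
  by apply: contra yz => /eqP/(congr1 val)/= ->.
move=> i; apply/bigfcupP/flatten_mapP => [[y /andP[ys _] iy]|[y ys iy]]; exists y => //.
by rewrite ys.
Qed.

(** An object without labels could occur twice without repeating a label. As there is none, distinct
    labels force distinct objects, and the list is the enumeration of a set. *)
Lemma lset_ex (p : pred nat) A (s : seq A) : (forall x : A, lseq x <> [::]) ->
    p (size s) -> uniq (flatten (map (@lseq A) s)) ->
  exists x : lset p A, perm_eq (enum_fset (val x)) s.
Proof.
move=> ne ps ufl.
have dis : uniq s /\ {in s &, forall x y, x != y -> [disjoint labels x & labels y]%fset}.
  elim: s {ps} ufl => //= x s IHs; rewrite cat_uniq => /and3P[_ /hasPn disx /IHs[us dis]].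
  have dx y : y \in s -> [disjoint labels x & labels y]%fset.
    move=> ys; apply/fdisjointP=> i ix; apply/negP=> iy.
    by have /disx/negP[] : i \in flatten (map (@lseq A) s) by apply/flatten_mapP; exists y.
  split.
    rewrite us andbT; apply/negP=> xs; case Ex: (lseq x) (ne x) => [//|i l] _.
    have ix : i \in labels x by rewrite -[_ \in _]/(i \in lseq x) Ex mem_head.
    by have /fdisjointP/(_ i ix) := dx x xs; rewrite ix.
  move=> y z; rewrite !inE => /orP[/eqP->|ys] /orP[/eqP->|zs]; rewrite ?eqxx //.
  - by move=> _; apply: dx.
  - by move=> _; rewrite fdisjoint_sym; apply: dx.
  - exact: dis.
have [us {}dis] := dis; pose S := [fset y in s]%fset.
have pS : perm_eq (enum_fset S) s.
  by apply: uniq_perm; rewrite ?fset_uniq // => y; rewrite !inE.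
have PS : p #|` S|%fset && pairwise_disjoint S.
  rewrite [#|` S|%fset](perm_size pS) ps; apply/forallP=> y; apply/forallP=> z.
  apply/implyP=> yz; apply: dis; first by have := valP y; rewrite !inE.
    by have := valP z; rewrite !inE.
  by apply: contra yz => /eqP/val_inj->.
by exists (Sub S PS : lset p A).
Qed.

Lemma lset_inj p A (x y : lset p A) :
  perm_eq (enum_fset (val x)) (enum_fset (val y)) -> x = y.
Proof. by move/perm_mem=> E; apply/val_inj/fsetP. Qed.

Lemma lprod_seq A B (z : (A * B)%L) :
  perm_eq (lseq z) (lseq (val z).1 ++ lseq (val z).2).
Proof.
case: z => -[a b] dab; apply: uniq_perm; first exact: fset_uniq.
  rewrite cat_uniq !lseq_uniq andbT /=; apply/hasPn=> i ib; apply/negP=> ia.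
  by move/fdisjointP/(_ i ia): dab; rewrite ib.
by move=> i; rewrite mem_cat inE.
Qed.

Lemma lprod_ex A B (a : A) (b : B) : uniq (lseq a ++ lseq b) ->
  exists z : (A * B)%L, val z = (a, b).
Proof.
rewrite cat_uniq => /and3P[_ /hasPn dab _].
have D : [disjoint labels (a, b).1 & labels (a, b).2]%fset.
  by apply/fdisjointP=> i ia; apply/negP=> /dab; rewrite /= ia.
by exists (Sub (a, b) D : (A * B)%L).
Qed.

Lemma latom_seq (i : latom) : lseq i = [:: i].
Proof.
by apply: perm_small_eq => //; apply: uniq_perm; rewrite ?fset_uniq // => j; rewrite !inE.
Qed.

End LabeledConstructions.

Section LabeledSpec.
Variables (SX K : lclass).
Local Notation O := (latom + SX)%L.
Variables (fX : SX -> (latom * lset_ge 1 K)%L) (fK : K -> (lset_eq 2 O)).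
Hypotheses (fX_bij : bijective fX) (fX_labels : forall x, labels (fX x) = labels x)
  (fK_bij : bijective fK) (fK_labels : forall k, labels (fK k) = labels k).

Definition lroot (o : O) : nat :=
  match o with inl i => i | inr x => (val (fX x)).1 end.
Definition lkids (o : O) : seq K :=
  match o with inl _ => [::] | inr x => enum_fset (val (val (fX x)).2) end.
Definition lcorners (k : K) : seq O := enum_fset (val (fK k)).

Lemma lolabE (o : O) :
  perm_eq (lseq o) (lroot o :: flatten (map (@lseq K) (lkids o))).
Proof.
case: o => [i|x]; first by rewrite /= -latom_seq.
rewrite -[lseq _]/(enum_fset (labels x)) -fX_labels.
apply: perm_trans (lprod_seq _) _; rewrite latom_seq perm_cons.
exact: lset_seq.
Qed.

Lemma ltlabE (k : K) : perm_eq (lseq k) (flatten (map (@lseq O) (lcorners k))).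
Proof. by rewrite /lseq -fK_labels; apply: lset_seq. Qed.

Lemma size_lcorners (k : K) : size (lcorners k) = 2.
Proof. by rewrite /lcorners; case: (fK k) => s /= /andP[/eqP + _]. Qed.

Lemma lobj_seq_neq0 (o : O) : lseq o <> [::].
Proof. by move=> E; have /perm_size := lolabE o; rewrite E. Qed.

Lemma ltri_seq_neq0 (k : K) : lseq k <> [::].
Proof.
move=> E; have /perm_size := ltlabE k; rewrite E.
case: (lcorners k) (size_lcorners k) => // o s _ /=; rewrite size_cat.
by case: (lseq o) (@lobj_seq_neq0 o).
Qed.

(** The number of kids tells the two summands apart: none for an atom, at least one in S_X. *)
Lemma lobj_inj (o1 o2 : O) :
  lroot o1 = lroot o2 -> perm_eq (lkids o1) (lkids o2) -> o1 = o2.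
Proof.
have kids_gt0 x : 0 < size (lkids (inr x)).
  by rewrite /=; case: (val (fX x)) => i [s /= /andP[+ _]].
case: o1 o2 => [i|x] [j|y] => [/= -> //|_ /perm_size E|_ /perm_size E|Er Ek].
- by have := kids_gt0 y; rewrite -E.
- by have := kids_gt0 x; rewrite E.
congr inr; apply: (bij_inj fX_bij); apply: val_inj.
move: Er Ek; rewrite /=; case: (val (fX x)) (val (fX y)) => i s [j s'] /= -> Ek.
by congr (_, _); apply: lset_inj.
Qed.

Lemma ltri_inj (k1 k2 : K) : perm_eq (lcorners k1) (lcorners k2) -> k1 = k2.
Proof. by move/lset_inj/(bij_inj fK_bij). Qed.

Lemma lobj_ex (i : nat) (s : seq K) : uniq (i :: flatten (map (@lseq K) s)) ->
  exists2 o : O, lroot o = i & perm_eq (lkids o) s.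
Proof.
case: s => [_|k s]; first by exists (inl i).
move=> u; have [|S pS] := lset_ex (p := fun i => 1 <= i) ltri_seq_neq0 _ (proj2 (andP u)) => //.
have [|z Ez] := @lprod_ex latom _ i S.
  rewrite latom_seq (perm_uniq (perm_cat (perm_refl [:: i]) (lset_seq S))).
  by rewrite (perm_uniq (s2 := i :: flatten (map (@lseq K) (k :: s)))) //
    perm_cons perm_flatten_map.
have [gX _ gK] := fX_bij; exists (inr (gX z)); rewrite /= gK Ez //.
Qed.

Lemma ltri_ex (s : seq O) : size s = 2 -> uniq (flatten (map (@lseq O) s)) ->
  exists k : K, perm_eq (lcorners k) s.
Proof.
move=> sz u; have [|S pS] := lset_ex (p := fun i => i == 2) lobj_seq_neq0 _ u; first exact/eqP.
by have [gK _ gKK] := fK_bij; exists (gK S); rewrite /lcorners gKK.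
Qed.

Lemma uniq_perm_imply (s1 s2 : seq nat) : perm_eq s1 s2 -> uniq s1 -> uniq s2.
Proof. by move/perm_uniq->. Qed.

Lemma uniq_catl (s1 s2 : seq nat) : uniq (s1 ++ s2) -> uniq s1.
Proof. by rewrite cat_uniq => /and3P[]. Qed.

Definition lspec : spec nat :=
  Spec uniq_perm_imply uniq_catl (@lseq_uniq O) lolabE ltlabE size_lcorners
    lobj_inj ltri_inj lobj_ex ltri_ex.

End LabeledSpec.

Lemma has_card_ext (T : eqType) (P Q : T -> Prop) m :
  (forall x, P x <-> Q x) -> has_card P m -> has_card Q m.
Proof. by move=> PQ [s [us ss sP]]; exists s; split=> // x; rewrite sP. Qed.

Lemma norbits_dissymmetry_int (V : finType) (G : {group {perm V}}) :
  (#|orbit (relabel_action V) G @: unmarked V|%:Z =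
   #|orbit (relabel_action V) G @: structs Triangle (valid Triangle)|%:Z +
   #|orbit (relabel_action V) G @: structs Vertex (valid Vertex)|%:Z -
   #|orbit (relabel_action V) G @: structs Flag (valid Flag)|%:Z)%R.
Proof. by have := norbits_dissymmetry G; lia. Qed.

Section LabeledModels.
Variables (SC SX K TK TS TSK : lclass).
Local Notation O := (latom + SX)%L.
Hypotheses (hTK : liso TK (lset_eq 3 O)) (hTS : liso TS (latom * SC))
  (hTSK : liso TSK (K * SX)) (hSC : liso SC (lset_ge 2 K))
  (hSX : liso SX (latom * lset_ge 1 K)) (hK : liso K (lset_eq 2 O)).

Lemma labeled_models : exists S : spec nat, [/\ wf S = (@uniq nat : pred (seq nat)),
  exists R, model S Triangle (@lseq TK) R, exists R, model S Vertex (@lseq TS) R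
  & exists R, model S Flag (@lseq TSK) R].
Proof.
have [[fX [bX lX]] [fK [bK lK]]] := (hSX, hK).
pose S := lspec bX lX bK lK; exists S; split=> //.
- have [f [bf lf]] := hTK.
  have le x : perm_eq (flatten (map (@lseq O) (enum_fset (val (f x))))) (lseq x).
    by rewrite perm_sym [lseq x]/lseq -lf; apply: lset_seq.
  eexists; apply: (@triangle_model _ S TK (@lseq TK) (fun x => enum_fset (val (f x)))) => //.
  + by move=> x y /lset_inj/(bij_inj bf).
  + by move=> x; case: (f x) => s /= /andP[/eqP].
  move=> s sz us; have [gf _ gfK] := bf.
  have [|x px] := lset_ex (p := fun i => i == 3) (lobj_seq_neq0 lX) _ us; first exact/eqP.
  by exists (gf x); rewrite gfK.
- have [[f [bf lf]] [g [bg lg]]] := (hTS, hSC).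
  pose ks x := enum_fset (val (g (val (f x)).2)).
  have le x : perm_eq ((val (f x)).1 :: flatten (map (@lseq K) (ks x))) (lseq x).
    rewrite perm_sym [lseq x]/lseq -lf; apply: perm_trans (lprod_seq _) _.
    by rewrite latom_seq perm_cons [lseq _]/lseq -lg; apply: lset_seq.
  apply: (@vertex_model_kids _ S TS (@lseq TS) (fun x => (val (f x)).1) ks) => //.
  + by move=> x; have := perm_uniq (le x); rewrite lseq_uniq.
  + by move=> x; rewrite /ks; case: (g _) => s /= /andP[].
  + move=> x y Er /lset_inj/(bij_inj bg) Ek; apply: (bij_inj bf); apply: val_inj.
    by move: Er Ek; case: (val (f x)) (val (f y)) => [? ?] [? ?] /= -> ->.
  move=> i s /= u sz; have [[gf _ gfK] [gg _ ggK]] := (bf, bg).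
  have [//||x px] := lset_ex (p := fun i => 2 <= i) (s := s) (ltri_seq_neq0 lX lK).
    by case/andP: u.
  have [|z Ez] := @lprod_ex latom _ i (gg x).
    rewrite latom_seq (perm_uniq (s2 := i :: flatten (map (@lseq K) s))) //.
    rewrite perm_cons [lseq _]/lseq -lg ggK; apply: perm_trans (lset_seq _) _.
    exact: perm_flatten_map.
  by exists (gf z); rewrite /ks gfK Ez //= ggK.
- have [f [bf lf]] := hTSK.
  have le x : perm_eq (lseq (val (f x)).1 ++ lseq (val (f x)).2) (lseq x).
    by rewrite perm_sym [lseq x]/lseq -lf; apply: lprod_seq.
  eexists; apply: (@flag_model _ S TSK (@lseq TSK)
    (fun x => ((val (f x)).1, inr (val (f x)).2 : O))) => //.
  + move=> x y [E1 E2]; apply: (bij_inj bf); apply: val_inj.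
    by rewrite [val (f x)]surjective_pairing [val (f y)]surjective_pairing E1 E2.
  have [gf _ gfK] := bf; move=> [k o]; split=> [[/= ne u]|[x <-]] /=.
    case: o ne u => [//|y] _ u; have [//|z Ez] := @lprod_ex K SX k y.
    by exists (gf z); rewrite gfK Ez.
  split; last by have := perm_uniq (le x); rewrite lseq_uniq.
  by case: (val (fX _)) => i [s /= /andP[+ _]] E; rewrite E.
Qed.

Theorem labeled_count (n : nat) : exists tk ts tsk : nat,
  [/\ lcount TK n tk, lcount TS n ts, lcount TSK n tsk
    & (#|labeled_cacti n|%:Z = tk%:Z + ts%:Z - tsk%:Z)%R].
Proof.
have [S [wfS [RT mT] [RV mV] [RF mF]]] := labeled_models.
(* The elements of ['I_n] start at 0, the labels at 1. *)
pose f (i : 'I_n) := i.+1.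
have f_inj : injective f by move=> i j [] /val_inj.
have fE : map f (enum 'I_n) = iota 1 n.
  by rewrite (iotaDl 1 0) -val_enum_ord -map_comp; apply: eq_map.
have memG (s : {perm 'I_n}) : s \in [1 {perm 'I_n}]%g <-> f \o s =1 f.
  split=> [/set1P-> i|fs]; first by rewrite /= perm1.
  by apply/set1P/permP=> i; rewrite perm1; apply: f_inj; apply: fs.
have wf_enum : wf S (map f (enum 'I_n)) by rewrite wfS fE iota_uniq.
have count k T lT R := @count_model _ _ S f 1%G wf_enum memG k T lT R.
have lE (A : lclass) m : has_card (fun x : A => perm_eq (lseq x) (map f (enum 'I_n))) m ->
    lcount A n m.
  apply: has_card_ext => x; rewrite fE; split=> [p|E].
    by apply/fsetP=> i; rewrite !inE -(perm_mem p).
  by rewrite /lseq E; apply: uniq_perm; rewrite ?fset_uniq ?iota_uniq // => i; rewrite !inE.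
do 3!eexists; split; [exact: lE (count _ _ _ _ mT)|exact: lE (count _ _ _ _ mV)
  |exact: lE (count _ _ _ _ mF)|].
by rewrite -norbits_labeled norbits_dissymmetry_int.
Qed.

End LabeledModels.

(** * Unlabeled classes *)

Lemma perm_unit (s1 s2 : seq unit) : perm_eq s1 s2 = (size s1 == size s2).
Proof.
have nseqE (s : seq unit) : s = nseq (size s) tt by elim: s => //= -[] s <-.
by apply/idP/eqP=> [/perm_size //|E]; rewrite (nseqE s1) (nseqE s2) E.
Qed.

Section UnlabeledConstructions.
Implicit Types A : uclass.

(** The size in unary: equality of label lists up to permutation becomes equality of sizes, and
    [spec] covers this setting too. *)
Definition useq A (x : A) : seq unit := nseq (usize x) tt.

Lemma size_useq A (x : A) : size (useq x) = usize x.
Proof. exact: size_nseq. Qed.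

Lemma size_flatten_useq A (s : seq A) :
  size (flatten (map (@useq A) s)) = \sum_(x <- s) usize x.
Proof.
elim: s => [|x s IHs]; first by rewrite big_nil.
by rewrite big_cons /= size_cat IHs size_useq.
Qed.

Lemma size_uset p A (x : uset p A) :
  usize x = size (flatten (map (@useq A) (enum_mset (val x)))).
Proof. by rewrite size_flatten_useq. Qed.

Lemma uset_ex (p : pred nat) A (s : seq A) : p (size s) ->
  exists x : uset p A, perm_eq (enum_mset (val x)) s.
Proof.
move=> ps; have P : p (size (enum_mset (seq_mset s))) by rewrite (perm_size (perm_eq_seq_mset s)).
by exists (Sub (seq_mset s) P : uset p A); apply: perm_eq_seq_mset.
Qed.

Lemma uset_inj p A (x y : uset p A) :
  perm_eq (enum_mset (val x)) (enum_mset (val y)) -> x = y.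
Proof. by move/eq_seq_msetP; rewrite !seq_mset_id => /val_inj. Qed.

End UnlabeledConstructions.

Section UnlabeledSpec.
Variables (SX K : uclass).
Local Notation O := (uatom + SX)%U.
Variables (fX : SX -> (uatom * uset_ge 1 K)%U) (fK : K -> (uset_eq 2 O)).
Hypotheses (fX_bij : bijective fX) (fX_size : forall x, usize (fX x) = usize x)
  (fK_bij : bijective fK) (fK_size : forall k, usize (fK k) = usize k).

Definition ukids (o : O) : seq K :=
  match o with inl _ => [::] | inr x => enum_mset (val (fX x).2) end.
Definition ucorners (k : K) : seq O := enum_mset (val (fK k)).

Lemma uolabE (o : O) : perm_eq (useq o) (tt :: flatten (map (@useq K) (ukids o))).
Proof.
rewrite perm_unit size_useq /=; case: o => [//|x] /=.
by rewrite -fX_size /= -size_uset.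
Qed.

Lemma utlabE (k : K) : perm_eq (useq k) (flatten (map (@useq O) (ucorners k))).
Proof. by rewrite perm_unit size_useq -fK_size size_uset. Qed.

Lemma size_ucorners (k : K) : size (ucorners k) = 2.
Proof. by rewrite /ucorners; case: (fK k) => s /= /eqP. Qed.

Lemma uobj_inj (o1 o2 : O) : tt = tt -> perm_eq (ukids o1) (ukids o2) -> o1 = o2.
Proof.
move=> _; have kids_gt0 x : 0 < size (ukids (inr x)).
  by rewrite /=; case: (fX x) => i [s].
case: o1 o2 => [[]|x] [[]|y] => [//|/perm_size E|/perm_size E|Ek].
- by have := kids_gt0 y; rewrite -E.
- by have := kids_gt0 x; rewrite E.
congr inr; apply: (bij_inj fX_bij).
move: Ek; rewrite /=; case: (fX x) (fX y) => [[] s] [[] s'] /= Ek.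
by congr (_, _); apply: uset_inj.
Qed.

Lemma utri_inj (k1 k2 : K) : perm_eq (ucorners k1) (ucorners k2) -> k1 = k2.
Proof. by move/uset_inj/(bij_inj fK_bij). Qed.

Lemma uobj_ex (i : unit) (s : seq K) : xpredT (i :: flatten (map (@useq K) s)) ->
  exists2 o : O, tt = i & perm_eq (ukids o) s.
Proof.
case: i => _; case: s => [|k s]; first by exists (inl tt).
have [//|S pS] := uset_ex (p := fun i => 1 <= i) (s := k :: s).
by have [gX _ gK] := fX_bij; exists (inr (gX (tt, S))); rewrite //= gK.
Qed.

Lemma utri_ex (s : seq O) : size s = 2 -> xpredT (flatten (map (@useq O) s)) ->
  exists k : K, perm_eq (ucorners k) s.
Proof.
move=> sz _; have [|S pS] := uset_ex (p := fun i => i == 2) (s := s); first exact/eqP.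
by have [gK _ gKK] := fK_bij; exists (gK S); rewrite /ucorners gKK.
Qed.

Definition uspec : spec unit :=
  @Spec unit xpredT O K (@useq O) (@useq K) (fun=> tt) ukids ucorners
    (fun _ _ _ _ => isT) (fun _ _ _ => isT) (fun=> isT)
    uolabE utlabE size_ucorners uobj_inj utri_inj uobj_ex utri_ex.

End UnlabeledSpec.

Section UnlabeledModels.
Variables (SC SX K TK TS TSK : uclass).
Local Notation O := (uatom + SX)%U.
Hypotheses (hTK : uiso TK (uset_eq 3 O)) (hTS : uiso TS (uatom * SC))
  (hTSK : uiso TSK (K * SX)) (hSC : uiso SC (uset_ge 2 K))
  (hSX : uiso SX (uatom * uset_ge 1 K)) (hK : uiso K (uset_eq 2 O)).

Lemma unlabeled_models : exists S : spec unit, [/\ forall s, wf S s,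
  exists R, model S Triangle (@useq TK) R, exists R, model S Vertex (@useq TS) R
  & exists R, model S Flag (@useq TSK) R].
Proof.
have [[fX [bX lX]] [fK [bK lK]]] := (hSX, hK).
pose S := uspec bX lX bK lK; exists S; split=> //.
- have [f [bf lf]] := hTK.
  eexists; apply: (@triangle_model _ S TK (@useq TK) (fun x => enum_mset (val (f x)))) => //.
  + by move=> x y /uset_inj/(bij_inj bf).
  + by move=> x; rewrite perm_unit size_useq -lf size_uset.
  + by move=> x; case: (f x) => s /= /eqP.
  move=> s sz _; have [gf _ gfK] := bf.
  have [|x px] := uset_ex (p := fun i => i == 3) (s := s); first exact/eqP.
  by exists (gf x); rewrite gfK.
- have [[f [bf lf]] [g [bg lg]]] := (hTS, hSC).
  pose ks x := enum_mset (val (g (f x).2)).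
  apply: (@vertex_model_kids _ S TS (@useq TS) (fun=> tt) ks) => //.
  + by move=> x; rewrite /ks; case: (g _).
  + move=> x y _ /uset_inj/(bij_inj bg) Ek; apply: (bij_inj bf).
    by move: Ek; case: (f x) (f y) => [[] ?] [[] ?] /= ->.
  + move=> [] s _ sz; have [[gf _ gfK] [gg _ ggK]] := (bf, bg).
    have [//|x px] := uset_ex (p := fun i => 2 <= i) (s := s).
    by exists (gf (tt, gg x)); rewrite // /ks gfK ggK.
  + by move=> x; rewrite perm_unit size_useq -lf /= -lg size_uset.
- have [f [bf lf]] := hTSK.
  eexists; apply: (@flag_model _ S TSK (@useq TSK) (fun x => ((f x).1, inr (f x).2 : O))) => //.
  + move=> x y [E1 E2]; apply: (bij_inj bf).
    by rewrite [f x]surjective_pairing [f y]surjective_pairing E1 E2.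
  + by move=> x; rewrite perm_unit size_cat !size_useq -lf.
  have [gf _ gfK] := bf; move=> [k o]; split=> [[/= ne _]|[x <-]] /=.
    by case: o ne => [//|y] _; exists (gf (k, y)); rewrite gfK.
  by split=> //; case: (fX _) => i [s /= +] E; rewrite E.
Qed.

Theorem unlabeled_count (n : nat) : exists tk ts tsk : nat,
  [/\ ucount TK n tk, ucount TS n ts, ucount TSK n tsk
    & (#|unlabeled_cacti n|%:Z = tk%:Z + ts%:Z - tsk%:Z)%R].
Proof.
have [S [wfS [RT mT] [RV mV] [RF mF]]] := unlabeled_models.
(* With a constant labelling every permutation preserves the labels, so orbits are taken under the
   full symmetric group. *)
pose f (i : 'I_n) := tt.
have memG (s : {perm 'I_n}) : s \in [set: {perm 'I_n}]%G <-> f \o s =1 f by rewrite inE.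
have count k T lT R := @count_model _ _ S f [set: {perm 'I_n}]%G (wfS _) memG k T lT R.
have uE (A : uclass) m : has_card (fun x : A => perm_eq (useq x) (map f (enum 'I_n))) m ->
    ucount A n m.
  apply: has_card_ext => x; rewrite perm_unit size_useq size_map size_enum_ord.
  by split=> [/eqP|->].
do 3!eexists; split; [exact: uE (count _ _ _ _ mT)|exact: uE (count _ _ _ _ mV)
  |exact: uE (count _ _ _ _ mF)|].
by rewrite -norbits_unlabeled norbits_dissymmetry_int.
Qed.

End UnlabeledModels.

Theorem theorem12 :
  (forall (SC SX K TK TS TSK : lclass)
     (hTK : liso TK (lset_eq 3 (latom + SX)))
     (hTS : liso TS (latom * SC))
     (hTSK : liso TSK (K * SX))
     (hSC : liso SC (lset_ge 2 K))
     (hSX : liso SX (latom * lset_ge 1 K))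
     (hK : liso K (lset_eq 2 (latom + SX))),
   forall n : nat, exists tk ts tsk : nat,
     [/\ lcount TK n tk, lcount TS n ts, lcount TSK n tsk
       & (#|labeled_cacti n|%:Z = tk%:Z + ts%:Z - tsk%:Z)%R])
  /\
  (forall (SC SX K TK TS TSK : uclass)
     (hTK : uiso TK (uset_eq 3 (uatom + SX)))
     (hTS : uiso TS (uatom * SC))
     (hTSK : uiso TSK (K * SX))
     (hSC : uiso SC (uset_ge 2 K))
     (hSX : uiso SX (uatom * uset_ge 1 K))
     (hK : uiso K (uset_eq 2 (uatom + SX))),
   forall n : nat, exists tk ts tsk : nat,
     [/\ ucount TK n tk, ucount TS n ts, ucount TSK n tsk
       & (#|unlabeled_cacti n|%:Z = tk%:Z + ts%:Z - tsk%:Z)%R]).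
Proof.
by split=> SC SX K TK TS TSK *; [apply: (@labeled_count SC SX K)|apply: (@unlabeled_count SC SX K)].
Qed.
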